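(* Consider the Cauchy problem for the $(3+1)$-dimensional relativistic Euler equations with $P(\rho)=k^2\rho^\gamma$ ($k>0$, $\gamma\ge1$, $c>0$): $$\Big(\frac{\rho+P|u|^2/c^4}{1-|u|^2/c^2}\Big)_t+\mathrm{div}\Big(\frac{(\rho+P/c^2)u}{1-|u|^2/c^2}\Big)=0,\qquad \Big(\frac{(\rho+P/c^2)u}{1-|u|^2/c^2}\Big)_t+\mathrm{div}\Big(\frac{\rho+P/c^2}{1-|u|^2/c^2}\,u\otimes u\Big)+\nabla P=0,$$ with $(\rho,u)|_{t=0}=(\rho_0,u_0)$ on $\mathbb{R}^3$. If the initial data $(\rho_0,u_0)$ have a hyperbolic singularity set $V$, then the regular solution $(\rho,u)$ on $[0,T_m]\times\mathbb{R}^3$ of this Cauchy problem with maximal existence time $T_m$ blows up in finite time, i.e. $T_m<+\infty$.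
   Context: Regular solution: for $T>0$, $(\rho,u)$ is a regular solution on $[0,T]\times\mathbb{R}^3$ if it satisfies the Cauchy problem in the sense of distributions and (A) $\rho\ge0$, $(\rho,u)\in C^1([0,T]\times\mathbb{R}^3)$; (B) $|u|<c$ and $\sqrt{P'(\rho)}<c$; (C) $u_t+u\cdot\nabla u=0$ whenever $\rho(t,x)=0$. The maximal existence time $T_m\in(0,\infty]$ is the supremum of times up to which the regular solution exists. Hyperbolic singularity set: a smooth nonempty open set $V\subset\mathbb{R}^3$ such that $\rho_0(x)=0$ for all $x\in V$, and $Sp(\nabla u_0(x))\cap\mathbb{R}^-\neq\emptyset$ for all $x\in V$, where $Sp(\nabla u_0(x))$ is the spectrum of the Jacobian matrix of $u_0$ at $x$ and $\mathbb{R}^-$ is the set of negative real numbers. *)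

(* Defs.v *)
From HB Require Import structures.
From mathcomp Require Import all_boot all_order all_algebra.
From mathcomp Require Import all_classical all_reals all_analysis.

Set Implicit Arguments.
Unset Strict Implicit.
Unset Printing Implicit Defensive.

Import Order.TTheory GRing.Theory Num.Theory.
Import numFieldNormedType.Exports.

Local Open Scope classical_set_scope.
Local Open Scope ring_scope.

(* A point of space-time is a pair (t, x). *)
Notation spacetime R := (R * 'rV[R]_3)%type.

Definition dotp (R : realType) (u v : 'rV[R]_3) : R :=
  \sum_(i < 3) u 0 i * v 0 i.

(* The norm `|u| of the library on row vectors is the sup norm, hence this
   Euclidean norm. *)
Definition enorm (R : realType) (u : 'rV[R]_3) : R := Num.sqrt (dotp u u).

Section Smooth.
Variables (R : realType) (V : normedModType R).

Definition iter_derive (vs : seq V) (f : V -> R) : V -> R :=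
  foldr (fun v g => fun x => 'D_v g x) f vs.

(* C^infinity: every iterated directional derivative is differentiable. *)
Definition smooth (f : V -> R) : Prop :=
  forall (vs : seq V) (x : V), differentiable (iter_derive vs f) x.

(* Open set with C^infinity boundary, given by local defining functions. *)
Definition smooth_open (A : set V) : Prop :=
  open A /\
  forall x, (closure A `\` A) x ->
    exists g : V -> R,
      [/\ smooth g, exists v, 'D_v g x != 0 & \forall y \near x, A y <-> g y < 0].

End Smooth.

Section C1Slab.
Variables (R : realType) (W : normedModType R) (T : R).
Implicit Types (f : spacetime R -> W) (z : spacetime R).

Definition slab : set (spacetime R) := [set z | 0 <= z.1 <= T].

(* Increments h <> 0 tending to 0 with t + h in [0, T]: the time derivative is
   two-sided for 0 < t < T and one-sided at t = 0 and t = T. *)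
Definition time_incr (t : R) : set_system R :=
  within [set h | 0 <= t + h <= T] 0^'.

Definition time_quot f z : R -> W :=
  fun h => h^-1 *: (f (z.1 + h, z.2) - f z).

Definition Dt f z : W := lim (time_quot f z @ time_incr z.1).

Definition Dx (v : 'rV[R]_3) f z : W := 'D_v (fun y => f (z.1, y)) z.2.

Definition C1_slab f : Prop :=
  [/\ {within slab, continuous f},
      forall z, slab z -> cvg (time_quot f z @ time_incr z.1),
      {within slab, continuous (Dt f)},
      forall z i, slab z -> derivable (fun y => f (z.1, y)) z.2 (delta_mx 0 i) &
      forall i, {within slab, continuous (Dx (delta_mx 0 i) f)}].

End C1Slab.

Section Distributions.
Variable R : realType.

Definition point (t a b c : R) : spacetime R :=
  (t, \row_(i < 3) [:: a; b; c]`_i).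

(* The Lebesgue integral over R x R^3 as an iterated integral; it is only used
   for continuous functions with compact support. *)
Definition integral_spacetime (f : spacetime R -> R) : R :=
  let mu := @lebesgue_measure R in
  \int[mu]_t \int[mu]_a \int[mu]_b \int[mu]_c f (point t a b c).

Definition test_function (T : R) (phi : spacetime R -> R) : Prop :=
  [/\ smooth phi,
      compact (closure [set z | phi z != 0]) &
      closure [set z | phi z != 0] `<=` [set z | 0 < z.1 < T]].

(* a_t + div b = 0 in D'((0, T) x R^3) *)
Definition conservation_law (T : R) (a : spacetime R -> R)
    (b : spacetime R -> 'rV[R]_3) : Prop :=
  forall phi, test_function T phi ->
    integral_spacetime (fun z =>
      a z * 'D_(1, 0) phi z
      + \sum_(j < 3) b z 0 j * 'D_(0, delta_mx 0 j) phi z) = 0.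

End Distributions.

Section RelativisticEuler.
Variables (R : realType) (k gam c : R).

Definition pressure (r : R) : R := k ^+ 2 * r `^ gam.

(* The derivative of pressure on [0, +oo[, one-sided at 0; as 0 `^ 0 = 1, it is
   k ^ 2 at 0 when gam = 1, and 0 at 0 when gam > 1. *)
Definition dpressure (r : R) : R := k ^+ 2 * gam * r `^ (gam - 1).

Definition lorentz_denom (v : 'rV[R]_3) : R := 1 - enorm v ^+ 2 / c ^+ 2.

Definition energy (r : R) (v : 'rV[R]_3) : R :=
  (r + pressure r * enorm v ^+ 2 / c ^+ 4) / lorentz_denom v.

Definition momentum (r : R) (v : 'rV[R]_3) : 'rV[R]_3 :=
  ((r + pressure r / c ^+ 2) / lorentz_denom v) *: v.

(* v^T *m v is the tensor product of v with itself, and the gradient of the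
   pressure is written as the divergence of the scalar matrix (P(r))%:M. *)
Definition momentum_flux (r : R) (v : 'rV[R]_3) : 'M[R]_3 :=
  ((r + pressure r / c ^+ 2) / lorentz_denom v) *: (v^T *m v) + (pressure r)%:M.

Definition euler_equations (T : R) (rho : spacetime R -> R)
    (u : spacetime R -> 'rV[R]_3) : Prop :=
  conservation_law T (fun z => energy (rho z) (u z))
                     (fun z => momentum (rho z) (u z)) /\
  forall i : 'I_3,
    conservation_law T (fun z => momentum (rho z) (u z) 0 i)
                       (fun z => row i (momentum_flux (rho z) (u z))).

(* The initial condition is imposed pointwise: a weak formulation of it through
   the conserved quantities would not see u0 where rho0 vanishes. *)
Definition regular_solution (rho0 : 'rV[R]_3 -> R) (u0 : 'rV[R]_3 -> 'rV[R]_3)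
    (T : R) (rho : spacetime R -> R) (u : spacetime R -> 'rV[R]_3) : Prop :=
  [/\ euler_equations T rho u,
      forall x, rho (0, x) = rho0 x /\ u (0, x) = u0 x,
      [/\ forall z, slab T z -> 0 <= rho z, C1_slab T rho & C1_slab T u],
      forall z, slab T z -> enorm (u z) < c /\ Num.sqrt (dpressure (rho z)) < c &
      forall z, slab T z -> rho z = 0 -> Dt T u z + Dx (u z) u z = 0].

Definition max_existence_time (rho0 : 'rV[R]_3 -> R)
    (u0 : 'rV[R]_3 -> 'rV[R]_3) : \bar R :=
  ereal_sup [set T%:E | T in
    [set T : R | 0 < T /\ exists rho u, regular_solution rho0 u0 T rho u]].

End RelativisticEuler.

Section HyperbolicSingularity.
Variable R : realType.

(* The real spectrum. The matrix of the library is the transpose of the usual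
   Jacobian matrix and its eigenvectors are row vectors, so that v is an
   eigenvector here iff 'D_v f x = a *: v. *)
Definition Sp (A : 'M[R]_3) : set R := [set a | eigenvalue A a].

Definition hyperbolic_singularity_set (rho0 : 'rV[R]_3 -> R)
    (u0 : 'rV[R]_3 -> 'rV[R]_3) (V : set 'rV[R]_3) : Prop :=
  [/\ smooth_open V,
      V !=set0,
      forall x, V x -> rho0 x = 0 &
      forall x, V x -> differentiable u0 x /\
        Sp (jacobian u0 x) `&` [set a | a < 0] !=set0].

End HyperbolicSingularity.

(* Main.v *)
(* Let x be in V and a the initial velocity there. The straight line x + t a
   carries vacuum for as long as the solution exists: in a tube
   |y - x - t a| < d exp (- l t) around it the field (1, u) points out of the
   tube, and where rho > 0 the equations give D rho <= L rho along (1, u), so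
   rho exp (- (L + 1) t) psi, with psi vanishing on the boundary of the tube, has
   no positive maximum. In the vacuum u solves the Burgers equation, hence
   u (t, x + t a) = a. The tube argument itself only needs |u (t, x + t a) - a| <= eta
   for a small eta > 0, and this bound is thereby improved to 0, so that it can
   never be lost.

   If v is an eigenvector of the Jacobian of u0 at x with eigenvalue al < 0, then
   at time t1 = - 1 / al the map y |-> y + t1 u0 y has derivative
   (1 + t1 al) v = 0 in the direction v, while u (t1, y + t1 u0 y) = u0 y has
   derivative al v <> 0: no C^1 solution reaches a time beyond t1.

   The distributional equations hold pointwise where rho > 0: testing a
   divergence against a rescaled bump and using only the first-order Taylor
   expansion of the fluxes at one point gives their divergence there. *)

Require Import Defs.
From HB Require Import structures.
From mathcomp Require Import all_boot all_order all_algebra.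
From mathcomp Require Import all_classical all_reals all_analysis.
From mathcomp Require Import ring lra.

Import Order.TTheory GRing.Theory Num.Theory.
Import numFieldNormedType.Exports.

Local Open Scope classical_set_scope.
Local Open Scope ring_scope.

Set Implicit Arguments.
Unset Strict Implicit.

(** * Smooth bump functions *)

(** The equations are only weak, and the power in the pressure is differentiated only at positive
    density, so the balance laws are available pointwise only where [rho > 0]. A positive maximum of
    the weighted density lies in exactly that region; this is why vacuum is propagated by a maximum
    argument and not by following [rho] along trajectories. No flow of [u] is ever constructed: the
    only curves are straight segments in space-time.

    The bounds are taken on one compact box fixed in advance, large enough for the tube and for the
    short backward segments used at the maximum. The bound [B] on the derivatives of [u] there fixes
    the contraction rate [l] of the tube, and [delta * expR (- l * t1)], the smallest tube radius up
    to [t1], serves as eta. None of these constants depends on how long the velocity is known to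
    stay near [a], so the continuation in time can use them unchanged.

    The bound on the sound speed enters through [K * pressure <= rho] with [K = 1 / c^2], which
    makes the growth estimate for [rho] linear; the bound by [c] on the velocity limits how far the
    segments travel and keeps the Lorentz factor finite. *)

Definition flat (R : realType) (n : nat) (x : R) : R :=
  if 0 < x then x^-1 ^+ n * expR (- x^-1) else 0.

(** With [y = 1 / x] this is the exponential series bound [y^(n+1) / (n+1)! <= exp y]. The linear
    decay at 0 gives the derivative there, and later an explicit bound on the derivative of a
    bump. *)
Lemma flat_le (R : realType) (n : nat) (x : R) :
  0 < x -> flat n x <= (n.+1)`!%:R * x.
Proof.
move=> x0; rewrite /flat x0; set y := x^-1.
have y0 : 0 < y by rewrite invr_gt0.
have xE : x = y^-1 by rewrite invrK.
have F0 : 0 < (n.+1)`!%:R :> R by rewrite ltr0n fact_gt0.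
rewrite expRN xE ler_pdivrMr ?expR_gt0// mulrAC ler_pdivlMr// -exprSr.
rewrite -ler_pdivrMl// mulrC.
by apply: le_trans (expR_ge1Dxn n (ltW y0)); rewrite lerDr.
Qed.

Lemma flat_ge0 (R : realType) (n : nat) (x : R) : 0 <= flat n x.
Proof.
rewrite /flat; case: ifP => // x0.
by rewrite mulr_ge0 ?expR_ge0// exprn_ge0// invr_ge0 ltW.
Qed.

Lemma flat_eq0 (R : realType) (n : nat) (x : R) : x <= 0 -> flat n x = 0.
Proof. by rewrite /flat ltNge => ->. Qed.

(** The index [n] exists for this formula: with the weights [x^-n] the family is closed under
    differentiation up to linear combinations. At 0 the difference quotient of one member is the
    next member, which tends to 0 by [flat_le]. *)
Lemma is_derive_flat (R : realType) (n : nat) (x : R) :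
  is_derive x 1 (flat n) (flat n.+2 x - n%:R * flat n.+1 x).
Proof.
have [x0|x0|<-] := ltgtP 0 x.
- have x0' : x != 0 by rewrite gt_eqF.
  have nE : \near x,
      ((fun y : R => y^-1) ^+ n * (expR \o (fun y => - y^-1))) x = flat n x.
    near=> y; rewrite /flat.
    have -> : 0 < y by near: y; exact: lt_nbhsr.
    by rewrite exprfctE.
  apply: (near_eq_is_derive nE).
  have dV : is_derive x 1 (fun y : R => y^-1) (- x ^- 2).
    apply: DeriveDef; first exact: derivableV.
    by rewrite deriveV// derive_id /GRing.scale/= mulr1.
  have dN : is_derive x 1 (fun y : R => - y^-1) (x ^- 2).
    by have := is_deriveN dV; rewrite opprK.
  have dE := @is_derive1_comp R expR (fun y => - y^-1) _ _ _ (is_derive_expR _) dN.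
  apply: is_derive_eq.
  rewrite /GRing.scale/= /flat x0 /= exprfctE.
  case: n {nE} => [|n]; first by rewrite !expr0 /= mulr0n !exprS expr0; by field.
  rewrite !exprS /= -mulr_natr; move: (x^-1 ^+ n) (expR _) => A E; by field.
- have nE : \near x, cst 0 x = flat n x.
    by near=> y; rewrite flat_eq0// ltW//; near: y; exact: lt_nbhsl.
  apply: (near_eq_is_derive nE).
  by rewrite !flat_eq0 ?ltW// mulr0 subr0; exact: is_derive_cst.
- rewrite !flat_eq0 // mulr0 subr0.
  have H : h^-1 *: (flat n (h *: 1 + 0) - flat n (0 : R)) @[h --> 0^'] --> (0 : R).
    apply/cvgrPdist_le => e e0.
    near=> h; rewrite sub0r normrN /GRing.scale/= mulr1 addr0 (@flat_eq0 R n 0)// subr0.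
    have h0 : h != 0 by near: h; exact: nbhs_dnbhs_neq.
    have [hn|hp] := leP h 0; first by rewrite flat_eq0// mulr0 normr0 ltW.
    have -> : h^-1 * flat n h = flat n.+1 h by rewrite /flat hp mulrA -exprS.
    rewrite ger0_norm ?flat_ge0//; apply: le_trans (flat_le _ hp) _.
    rewrite -ler_pdivlMl ?ltr0n ?fact_gt0//.
    have : `|h| <= (n.+2)`!%:R^-1 * e.
      near: h. apply: dnbhs0_le. rewrite mulr_gt0// invr_gt0 ltr0n fact_gt0//.
    by rewrite gtr0_norm.
  apply: DeriveDef.
  + by apply/cvg_ex; exists 0.
  + exact: (cvg_lim _ H).
Unshelve. all: by end_near.
Qed.

Lemma derive_comp_scalar (R : realType) (V : normedModType R) (g : R -> R)
    (f : V -> R) (x v : V) (dg : R) :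
  is_derive (f x) 1 g dg -> differentiable f x ->
  is_derive x v (g \o f) (dg * 'D_v f x).
Proof.
move=> dgP df.
have dg' : differentiable g (f x) by apply/derivable1_diffP; case: dgP.
apply: DeriveDef; first exact/diff_derivable/differentiable_comp.
rewrite deriveE; last exact: differentiable_comp.
rewrite diff_comp// /= deriveE// diff1E// /= derive1E.
by case: dgP => _ ->; rewrite /GRing.scale/= mulrC.
Qed.

(* A class of functions stable under directional derivatives whose members are
   all differentiable: this is what makes [smooth] provable for bumps. *)
Inductive flat_expr (R : realType) (V : normedModType R) : (V -> R) -> Prop :=
| flat_expr_cst c : flat_expr (cst c)
| flat_expr_flat n (l : V -> R) :
    (forall x, differentiable l x) ->
    (forall v, exists c, forall x, 'D_v l x = c) -> flat_expr (flat n \o l)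
| flat_exprD f g : flat_expr f -> flat_expr g -> flat_expr (f + g)
| flat_exprM f g : flat_expr f -> flat_expr g -> flat_expr (f * g).

Lemma flat_expr_differentiable (R : realType) (V : normedModType R) (f : V -> R) :
  flat_expr f -> forall x, differentiable f x.
Proof.
elim=> [c|n l dl _|g h _ dg _ dh|g h _ dg _ dh] x.
- exact: differentiable_cst.
- apply: differentiable_comp => //.
  by apply/derivable1_diffP; case: (is_derive_flat n (l x)).
- exact: differentiableD.
- exact: differentiableM.
Qed.

(** Since [l] has constant directional derivatives, the chain-rule factor is a constant function and
    stays in the class. *)
Lemma flat_expr_derive (R : realType) (V : normedModType R) (f : V -> R) (v : V) :
  flat_expr f -> flat_expr (fun x => 'D_v f x).
Proof.
elim=> [c|n l dl cl|g h eg dg eh dh|g h eg dg eh dh].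
- have -> : (fun x => 'D_v (cst c) x) = cst 0 :> (V -> R).
    by apply/funext => x; rewrite derive_cst.
  exact: flat_expr_cst.
- have [c cE] := cl v.
  have -> : (fun x => 'D_v (flat n \o l) x) =
     (flat n.+2 \o l + cst (- n%:R) * (flat n.+1 \o l)) * cst c.
    apply/funext => x.
    have [_ ->] := derive_comp_scalar v (is_derive_flat n (l x)) (dl x).
    by rewrite cE /= mulNr.
  apply: flat_exprM; last exact: flat_expr_cst.
  apply: flat_exprD; first exact: flat_expr_flat.
  apply: flat_exprM; [exact: flat_expr_cst|exact: flat_expr_flat].
- have -> : (fun x => 'D_v (g + h) x) = (fun x => 'D_v g x) + (fun x => 'D_v h x).
    by apply/funext => x; rewrite deriveD//;
      apply/diff_derivable/flat_expr_differentiable.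
  exact: flat_exprD.
- have -> : (fun x => 'D_v (g * h) x) =
      g * (fun x => 'D_v h x) + h * (fun x => 'D_v g x).
    by apply/funext => x; rewrite deriveM//;
      apply/diff_derivable/flat_expr_differentiable.
  by apply: flat_exprD; apply: flat_exprM.
Qed.

Lemma flat_expr_smooth (R : realType) (V : normedModType R) (f : V -> R) :
  flat_expr f -> smooth f.
Proof.
move=> ef vs; apply: flat_expr_differentiable.
by elim: vs => //= v vs; exact: flat_expr_derive.
Qed.

(** * Iterated integrals of compactly supported continuous functions *)

Definition cont_supp (R : realType) (a e : R) (f : R -> R) : Prop :=
  continuous f /\ forall s, e < `|s - a| -> f s = 0.

Lemma cont_suppE (R : realType) (a e : R) (f : R -> R) :
  cont_supp a e f -> f = f \_ `[a - e, a + e].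
Proof.
move=> [_ f0]; apply/funext => s; rewrite /patch; case: ifPn => // H.
apply: f0; rewrite ltNge ler_distl; apply: contra H => H.
by rewrite inE /= in_itv.
Qed.

Lemma cont_supp_integrable (R : realType) (a e : R) (f : R -> R) :
  cont_supp a e f -> (@lebesgue_measure R).-integrable setT (EFin \o f).
Proof.
move=> cf; rewrite (cont_suppE cf) -restrict_EFin.
have mD : measurable (`[a - e, a + e]%classic : set R) by [].
apply: (@integrable_mkcond _ _ _ (@lebesgue_measure R) _ (EFin \o f) mD).1.
apply: continuous_compact_integrable.
  exact: segment_compact.
by apply: continuous_subspaceT; case: cf.
Qed.

Lemma cont_supp_Rintegral (R : realType) (a e : R) (f : R -> R) :
  cont_supp a e f -> let mu := @lebesgue_measure R in
  \int[mu]_s f s = \int[mu]_(s in `[a - e, a + e]) f s.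
Proof. by move=> cf /=; rewrite {1}(cont_suppE cf) -Rintegral_mkcond. Qed.

Lemma Rintegral_supp_bound (R : realType) (a e M : R) (f : R -> R) :
  0 < e -> cont_supp a e f -> (forall s, `|f s| <= M) ->
  `|\int[@lebesgue_measure R]_s f s| <= M * (e *+ 2).
Proof.
move=> e0 cf fM; rewrite (cont_supp_Rintegral cf).
have If : (@lebesgue_measure R).-integrable `[a - e, a + e] (EFin \o f).
  by apply: integrableS (cont_supp_integrable cf).
apply: le_trans (le_normr_Rintegral _ If) _ => //.
have -> : M * (e *+ 2) = \int[@lebesgue_measure R]_(s in `[a - e, a + e]) M.
  rewrite Rintegral_cst//; congr (_ * _).
  have -> : e *+ 2 = fine (e *+ 2)%:E by [].
  congr fine; apply: esym; apply: etrans (lebesgue_measure_itv _) _.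
  rewrite /= lte_fin ltrD2l gtrN// -EFinD; congr EFin.
  by ring.
have cI (g : R -> R) : continuous g ->
    (@lebesgue_measure R).-integrable `[a - e, a + e] (EFin \o g).
  move=> cg; apply: continuous_compact_integrable; first exact: segment_compact.
  exact: continuous_subspaceT.
apply: le_Rintegral => //; apply: cI; last exact: cst_continuous.
by move=> s; apply: continuous_comp; [case: cf => + _; exact|exact: norm_continuous].
Qed.

Lemma Rintegral_supp_derive (R : realType) (a e : R) (f df : R -> R) :
  0 < e -> cont_supp a e f -> continuous df ->
  (forall s : R, is_derive s (1 : R) f (df s)) ->
  \int[@lebesgue_measure R]_s df s = 0.
Proof.
move=> e0 cf cdf dfP.
(* The margin 1 makes [f] vanish identically around each point beyond radius [e + 1], hence [df]
   vanishes there too; it also puts the endpoints of integration where [f] is known to be 0. *)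
have e1 : 0 < e + 1 by lra.
have cdf' : cont_supp a (e + 1) df.
  split=> // s Hs; have nE : \near s, cst 0 s = f s.
    have : \forall t \near s, `|t - s| < 1.
      by near=> t; rewrite distrC; near: t; apply: nbhsx_ballx.
    apply: filterS => t ts /=; rewrite (cf.2 t)//.
    have := ler_distD t s a; rewrite (distrC s t); lra.
  have [_ <-] := dfP s.
  by rewrite -(near_eq_derive _ nE) derive_cst.
have f0 x : e < `|x - a| -> f x = 0 by exact: cf.2.
rewrite (cont_supp_Rintegral cdf') /Rintegral.
rewrite (@continuous_FTC2 _ _ f) ?f0//=; first by rewrite subr0.
- by rewrite addrAC subrr add0r normrN gtr0_norm; lra.
- by rewrite addrAC subrr add0r gtr0_norm; lra.
- by rewrite ltrD2l; lra.
- exact: continuous_subspaceT.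
- split=> [x _||]; first by case: (dfP x).
    by apply: cvg_at_right_filter; exact: cf.1.
  by apply: cvg_at_left_filter; exact: cf.1.
- by move=> x _; rewrite derive1E; case: (dfP x).
Unshelve. all: by end_near.
Qed.

(** The integrated variable effectively ranges over a fixed compact interval, on which [f (x, _)] is
    uniformly close to [f (x0, _)] for [x] near [x0]. The parameter space is arbitrary so that the
    result can be iterated through the fourfold integral. *)
Lemma Rintegral_supp_continuous (R : realType) (X : topologicalType) (a e : R)
    (f : X * R -> R) :
  0 < e -> continuous f -> (forall x s, e < `|s - a| -> f (x, s) = 0) ->
  continuous (fun x => \int[@lebesgue_measure R]_s f (x, s)).
Proof.
move=> e0 cf f0 x0.
have csx x : cont_supp a e (fun s => f (x, s)).
  split=> [s|s]; last exact: f0.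
  apply: (@continuous_comp _ _ _ (fun s => (x, s)) f); last exact: cf.
  by exact: (cvg_pair (cvg_cst x) cvg_id).
apply/cvgrPdist_le => d d0.
pose d' := d / (e *+ 2).
have d'0 : 0 < d' by rewrite divr_gt0// mulrn_wgt0.
have K : compact (`[a - e, a + e]%classic : set R) by exact: segment_compact.
(* the tube lemma, for the compact interval [a - e, a + e] *)
have near_x : \forall x \near x0,
    `[a - e, a + e] `<=` (fun s => `|f (x0, s) - f (x, s)| <= d').
  apply: ((compact_near_coveringP _).1 K X (nbhs x0)
    (fun x s => `|f (x0, s) - f (x, s)| <= d')) => s _.
  have c1 : f (x0, z.1) @[z --> (s, x0)] --> f (x0, s).
    apply: (@cvg_comp _ _ _ fst (fun s => f (x0, s))); first exact: cvg_fst.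
    by have [+ _] := csx x0; exact.
  have c2 : f (z.2, z.1) @[z --> (s, x0)] --> f (x0, s).
    apply: (@cvg_comp _ _ _ (fun z : R * X => (z.2, z.1)) f _ (nbhs (x0, s))).
      exact: (cvg_pair cvg_snd cvg_fst).
    exact: cf.
  have c12 : f (x0, z.1) - f (z.2, z.1) @[z --> (s, x0)] --> (0 : R).
    by rewrite -(subrr (f (x0, s))); exact: (cvgB c1 c2).
  exact: ((cvgr0Pnorm_le _).1 c12 _ d'0).
near=> x.
have csd : cont_supp a e (fun s => f (x0, s) - f (x, s)).
  split=> [s|s Hs]; last by rewrite !f0// subr0.
  by apply: continuousB; [have [+ _] := csx x0; exact|have [+ _] := csx x; exact].
rewrite -RintegralB//; [|exact: cont_supp_integrable (csx _)..].
have -> : d = d' * (e *+ 2) by rewrite divfK// mulrn_eq0/= gt_eqF.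
apply: (Rintegral_supp_bound e0 csd) => s.
have [H|H] := leP `|s - a| e; last by rewrite !f0// subr0 normr0 ltW.
have : `[a - e, a + e]%classic s by rewrite /= in_itv/= -ler_distl.
by move: s {H}; near: x.
Unshelve. all: by end_near.
Qed.

(* The four coordinates of space-time, time being number 0, and the basis. *)
Section Coordinates.
Variable R : realType.
Implicit Types (z : spacetime R) (m : 'I_4).

Definition co z m : R := oapp (fun j => z.2 0 j) z.1 (unlift ord0 m).

Definition dir m : spacetime R :=
  oapp (fun j => (0, delta_mx 0 j)) (1, 0) (unlift ord0 m).

Lemma co0 z : co z ord0 = z.1.
Proof. by rewrite /co unlift_none. Qed.

Lemma coS z (j : 'I_3) : co z (lift ord0 j) = z.2 0 j.
Proof. by rewrite /co liftK. Qed.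

Lemma dir0 : dir ord0 = (1, 0).
Proof. by rewrite /dir unlift_none. Qed.

Lemma dirS (j : 'I_3) : dir (lift ord0 j) = (0, delta_mx 0 j).
Proof. by rewrite /dir liftK. Qed.

Lemma coD z w m : co (z + w) m = co z m + co w m.
Proof. by rewrite /co; case: unliftP => [j|] _ //=; rewrite mxE. Qed.

Lemma coZ (k : R) z m : co (k *: z) m = k * co z m.
Proof. by rewrite /co; case: unliftP => [j|] _ //=; rewrite mxE. Qed.

Lemma coN z m : co (- z) m = - co z m.
Proof. by rewrite -scaleN1r coZ mulN1r. Qed.

Lemma coB z w m : co (z - w) m = co z m - co w m.
Proof. by rewrite coD coN. Qed.

Lemma co_dir m n : co (dir n) m = (m == n)%:R.
Proof.
case: (unliftP ord0 n) => [j ->|->]; case: (unliftP ord0 m) => [i ->|->];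
  rewrite ?coS ?co0 ?dirS ?dir0 /= ?mxE ?eqxx ?(inj_eq (@lift_inj _ _))//.
Qed.

Lemma co_inj z w : (forall m, co z m = co w m) -> z = w.
Proof.
case: z w => [t x] [t' x'] H; congr pair.
  by have := H ord0; rewrite !co0.
by apply/rowP => j; have := H (lift ord0 j); rewrite !coS.
Qed.

Lemma co_bigsum (I : Type) (s : seq I) (F : I -> spacetime R) m :
  co (\sum_(i <- s) F i) m = \sum_(i <- s) co (F i) m.
Proof.
elim/big_rec2: _ => [|i y x _ <-]; last by rewrite coD.
by rewrite -(scale0r (0 : spacetime R)) coZ mul0r.
Qed.

Lemma co_sum z : z = \sum_m co z m *: dir m.
Proof.
apply: co_inj => n; rewrite co_bigsum (bigD1 n)//= coZ co_dir eqxx mulr1.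
rewrite big1 ?addr0// => i ni.
by rewrite coZ co_dir eq_sym (negbTE ni) mulr0.
Qed.

Lemma normr_co_le z m : `|co z m| <= `|z|.
Proof.
rewrite prod_normE le_max; case: (unliftP ord0 m) => [j ->|->].
  rewrite coS [X in _ || (_ <= X)]/Num.norm/= mx_normrE; apply/orP; right.
  by apply/bigmax_geP; right; exists (0, j).
by rewrite co0 lexx.
Qed.

Lemma norm_le_co z (e : R) : 0 <= e -> (forall m, `|co z m| <= e) -> `|z| <= e.
Proof.
move=> e0 H; rewrite prod_normE ge_max; apply/andP; split.
  by have := H ord0; rewrite co0.
rewrite [X in X <= _]/Num.norm/= mx_normrE; apply/bigmax_leP; split=> // -[i j] _.
by rewrite ord1; have := H (lift ord0 j); rewrite coS.
Qed.

Lemma differentiable_co m z : differentiable (co^~ m) z.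
Proof.
case: (unliftP ord0 m) => [j ->|->].
  have -> : co^~ (lift ord0 j) = (fun M : 'rV[R]_3 => M 0 j) \o snd.
    by apply/funext => w; rewrite coS.
  apply: differentiable_comp; last exact: differentiable_coord.
  by apply: linear_differentiable => y; exact: cvg_snd.
have -> : co^~ ord0 = fst by apply/funext => w; rewrite co0.
by apply: linear_differentiable => y; exact: cvg_fst.
Qed.

Lemma derive_co m (v : spacetime R) z : 'D_v (co^~ m) z = co v m.
Proof.
apply: cvg_lim => //; apply: cvg_near_cst; near=> h.
rewrite /= coD coZ addrK /GRing.scale/= mulKf//.
by near: h; exact: nbhs_dnbhs_neq.
Unshelve. all: by end_near.
Qed.

End Coordinates.

(** * Linearity, size and product formula of the iterated integral for continuous functions
    supported in a box *)

Section BoxIntegral.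
Variable R : realType.
Implicit Types (z : spacetime R) (F G : spacetime R -> R) (e : R).
Local Notation mu := (@lebesgue_measure R).

Definition boxed z0 e F : Prop :=
  continuous F /\ forall z m, e < `|co z m - co z0 m| -> F z = 0.

Definition ax (k : nat) : 'I_4 := inord k.

Lemma co_point (t a b c : R) m :
  co (Defs.point t a b c) m = [:: t; a; b; c]`_m.
Proof.
rewrite /Defs.point; case: (unliftP ord0 m) => [j ->|->]; last by rewrite co0.
by rewrite coS /= mxE.
Qed.

Lemma point_sum (t a b c : R) :
  Defs.point t a b c =
  t *: dir R (ax 0) + a *: dir R (ax 1) + b *: dir R (ax 2) + c *: dir R (ax 3).
Proof.
apply: co_inj => m; rewrite co_point !coD !coZ !co_dir.
case: m => [[|[|[|[|//]]]] Hm]; rewrite -!val_eqE /= !inordK//=; ring.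
Qed.

Lemma continuous_point :
  continuous (fun p : R * R * R * R => Defs.point p.1.1.1 p.1.1.2 p.1.2 p.2).
Proof.
move=> p.
have -> : (fun p : R * R * R * R => Defs.point p.1.1.1 p.1.1.2 p.1.2 p.2) =
  (fun p => p.1.1.1 *: dir R (ax 0) + p.1.1.2 *: dir R (ax 1) +
     p.1.2 *: dir R (ax 2) + p.2 *: dir R (ax 3)).
  by apply/funext => q; rewrite point_sum.
have cfst (X Y : topologicalType) : continuous (@fst X Y) by move=> ?; exact: cvg_fst.
have csnd (X Y : topologicalType) : continuous (@snd X Y) by move=> ?; exact: cvg_snd.
have c1 : {for p, continuous (fun p : R * R * R * R => p.1.1.1)}.
  apply: (@continuous_comp _ _ _ fst (fun p : R * R * R => p.1.1)); first exact: cfst.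
  by apply: (@continuous_comp _ _ _ fst fst); exact: cfst.
have c2 : {for p, continuous (fun p : R * R * R * R => p.1.1.2)}.
  apply: (@continuous_comp _ _ _ fst (fun p : R * R * R => p.1.2)); first exact: cfst.
  by apply: (@continuous_comp _ _ _ fst snd); [exact: cfst|exact: csnd].
have c3 : {for p, continuous (fun p : R * R * R * R => p.1.2)}.
  by apply: (@continuous_comp _ _ _ fst snd); [exact: cfst|exact: csnd].
by apply: cvgD; [apply: cvgD; [apply: cvgD|]|]; apply: cvgZr_tmp => //; exact: csnd.
Qed.

Definition int3 F (t a b : R) : R := \int[mu]_c F (Defs.point t a b c).
Definition int2 F (t a : R) : R := \int[mu]_b int3 F t a b.
Definition int1 F (t : R) : R := \int[mu]_a int2 F t a.

Lemma integral_spacetimeE F : integral_spacetime F = \int[mu]_t int1 F t.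
Proof. by []. Qed.

Lemma Rintegral_zero (f : R -> R) : (forall s, f s = 0) -> \int[mu]_s f s = 0.
Proof.
move=> f0; have -> : f = cst 0 by apply/funext.
by rewrite Rintegral_cst// mul0r.
Qed.

Section Levels.
Variables (z0 : spacetime R) (e : R) (F : spacetime R -> R).
Hypotheses (e0 : 0 < e) (bF : boxed z0 e F).

Let F0 t a b c k : (k < 4)%N ->
  e < `|[:: t; a; b; c]`_k - co z0 (ax k)| -> F (Defs.point t a b c) = 0.
Proof.
by move=> k4 H; apply: (bF.2 _ (ax k)); rewrite co_point /ax inordK.
Qed.

(** Joint continuity in the remaining variables, from the innermost integral outwards, is what makes
    the integrand of each next level continuous and hence integrable. *)
Let cF3 : continuous (fun p : R * R * R => int3 F p.1.1 p.1.2 p.2).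
Proof.
apply: (@Rintegral_supp_continuous _ _ (co z0 (ax 3)) e
  (fun q => F (Defs.point q.1.1.1 q.1.1.2 q.1.2 q.2))) => //.
  move=> p; apply: (@continuous_comp _ _ _
    (fun q : R * R * R * R => Defs.point q.1.1.1 q.1.1.2 q.1.2 q.2) F).
    exact: continuous_point.
  exact: bF.1.
by move=> x s H; exact: (F0 (k := 3)).
Qed.

Let cF2 : continuous (fun p : R * R => int2 F p.1 p.2).
Proof.
apply: (@Rintegral_supp_continuous _ _ (co z0 (ax 2)) e
  (fun p : R * R * R => int3 F p.1.1 p.1.2 p.2)) => // -[t a] b H.
by apply: Rintegral_zero => c; exact: (F0 (k := 2)).
Qed.

Let cF1 : continuous (int1 F).
Proof.
apply: (@Rintegral_supp_continuous _ _ (co z0 (ax 1)) e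
  (fun p : R * R => int2 F p.1 p.2)) => // t a H.
by do 2 apply: Rintegral_zero => ?; exact: (F0 (k := 1)).
Qed.

Lemma boxed_int0 : cont_supp (co z0 (ax 0)) e (int1 F).
Proof.
split=> // t H.
by do 3 apply: Rintegral_zero => ?; exact: (F0 (k := 0)).
Qed.

Let cpair (X Y : topologicalType) (x : X) : continuous (fun y : Y => (x, y)).
Proof. by move=> y; exact: (cvg_pair (cvg_cst x) cvg_id). Qed.

Lemma boxed_int1 t : cont_supp (co z0 (ax 1)) e (int2 F t).
Proof.
split=> [a|a H].
  by apply: (@continuous_comp _ _ _ (fun a => (t, a))
    (fun p : R * R => int2 F p.1 p.2)); [exact: cpair|exact: cF2].
by do 2 apply: Rintegral_zero => ?; exact: (F0 (k := 1)).
Qed.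

Lemma boxed_int2 t a : cont_supp (co z0 (ax 2)) e (int3 F t a).
Proof.
split=> [b|b H].
  by apply: (@continuous_comp _ _ _ (fun b => (t, a, b))
    (fun p : R * R * R => int3 F p.1.1 p.1.2 p.2)); [exact: cpair|exact: cF3].
by apply: Rintegral_zero => ?; exact: (F0 (k := 2)).
Qed.

Lemma boxed_int3 t a b :
  cont_supp (co z0 (ax 3)) e (fun c => F (Defs.point t a b c)).
Proof.
split=> [c|c H]; last exact: (F0 (k := 3)).
apply: (@continuous_comp _ _ _ (Defs.point t a b) F); last exact: bF.1.
apply: (@continuous_comp _ _ _ (fun c => (t, a, b, c))
  (fun q : R * R * R * R => Defs.point q.1.1.1 q.1.1.2 q.1.2 q.2)).
  exact: cpair.
exact: continuous_point.
Qed.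

Lemma integral_spacetime_bound M : 0 <= M -> (forall z, `|F z| <= M) ->
  `|integral_spacetime F| <= M * (e *+ 2) ^+ 4.
Proof.
move=> M0 FM; rewrite 4!exprSr expr0 mul1r !mulrA integral_spacetimeE.
apply: (Rintegral_supp_bound e0 boxed_int0) => t.
apply: (Rintegral_supp_bound e0 (boxed_int1 t)) => a.
apply: (Rintegral_supp_bound e0 (boxed_int2 t a)) => b.
exact: (Rintegral_supp_bound e0 (boxed_int3 t a b)).
Qed.

End Levels.

Lemma boxedD z0 e F G : boxed z0 e F -> boxed z0 e G -> boxed z0 e (F \+ G).
Proof.
move=> [cF F0] [cG G0]; split=> [z|z m H]; first exact: (cvgD (cF z) (cG z)).
by rewrite /= (F0 z m)// (G0 z m)// addr0.
Qed.

Lemma boxedZ z0 e (k : R) F : boxed z0 e F -> boxed z0 e (fun z => k * F z).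
Proof.
move=> [cF F0]; split=> [z|z m H]; first exact: (cvgM (cvg_cst k) (cF z)).
by rewrite /= (F0 z m)// mulr0.
Qed.

Lemma integral_spacetimeD z0 e F G : 0 < e -> boxed z0 e F -> boxed z0 e G ->
  integral_spacetime (F \+ G) = integral_spacetime F + integral_spacetime G.
Proof.
move=> e0 bF bG.
have E3 t a b : int3 (F \+ G) t a b = int3 F t a b + int3 G t a b.
  rewrite /int3 RintegralD//.
  - exact: (cont_supp_integrable (boxed_int3 bF t a b)).
  - exact: (cont_supp_integrable (boxed_int3 bG t a b)).
have E2 t a : int2 (F \+ G) t a = int2 F t a + int2 G t a.
  rewrite /int2 (funext (E3 t a)) RintegralD//.
  - exact: (cont_supp_integrable (boxed_int2 e0 bF t a)).
  - exact: (cont_supp_integrable (boxed_int2 e0 bG t a)).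
have E1 t : int1 (F \+ G) t = int1 F t + int1 G t.
  rewrite /int1 (funext (E2 t)) RintegralD//.
  - exact: (cont_supp_integrable (boxed_int1 e0 bF t)).
  - exact: (cont_supp_integrable (boxed_int1 e0 bG t)).
rewrite !integral_spacetimeE (funext E1) RintegralD//.
- exact: (cont_supp_integrable (boxed_int0 e0 bF)).
- exact: (cont_supp_integrable (boxed_int0 e0 bG)).
Qed.

Lemma integral_spacetimeZ z0 e (k : R) F : 0 < e -> boxed z0 e F ->
  integral_spacetime (fun z => k * F z) = k * integral_spacetime F.
Proof.
move=> e0 bF; pose G := fun z => k * F z.
have E3 t a b : int3 G t a b = k * int3 F t a b.
  by rewrite /int3 RintegralZl//; exact: (cont_supp_integrable (boxed_int3 bF t a b)).
have E2 t a : int2 G t a = k * int2 F t a.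
  rewrite /int2 (funext (E3 t a)) RintegralZl//.
  exact: (cont_supp_integrable (boxed_int2 e0 bF t a)).
have E1 t : int1 G t = k * int1 F t.
  rewrite /int1 (funext (E2 t)) RintegralZl//.
  exact: (cont_supp_integrable (boxed_int1 e0 bF t)).
rewrite !integral_spacetimeE (funext E1) RintegralZl//.
exact: (cont_supp_integrable (boxed_int0 e0 bF)).
Qed.

Lemma boxed0 z0 e : boxed z0 e (cst 0).
Proof. by split=> // z; exact: cst_continuous. Qed.

Lemma boxed_sum (I : Type) (s : seq I) z0 e (H : I -> spacetime R -> R) :
  (forall i, boxed z0 e (H i)) -> boxed z0 e (fun z => \sum_(i <- s) H i z).
Proof.
move=> bH; elim: s => [|i s IH].
  by under eq_fun do rewrite big_nil; exact: boxed0.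
by under eq_fun do rewrite big_cons; exact: boxedD.
Qed.

Lemma integral_spacetime_sum (I : Type) (s : seq I) z0 e
    (H : I -> spacetime R -> R) : 0 < e -> (forall i, boxed z0 e (H i)) ->
  integral_spacetime (fun z => \sum_(i <- s) H i z) =
  \sum_(i <- s) integral_spacetime (H i).
Proof.
move=> e0 bH; elim: s => [|i s IH].
  under eq_fun do rewrite big_nil.
  by rewrite big_nil; do 4 apply: Rintegral_zero => ?.
under eq_fun do rewrite big_cons.
by rewrite big_cons -IH (integral_spacetimeD e0 (bH i) (boxed_sum s bH)).
Qed.

Definition tens (g : 'I_4 -> R -> R) z : R := \prod_m g m (co z m).

Lemma boxed_tens z0 e (g : 'I_4 -> R -> R) :
  (forall m, cont_supp (co z0 m) e (g m)) -> boxed z0 e (tens g).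
Proof.
move=> cg; split=> [z|z m H]; last first.
  by rewrite /tens (bigD1 m)//= (cg m).2// mul0r.
have c m : {for z, continuous (fun y => g m (co y m))}.
  refine (continuous_comp _ ((cg m).1 (co z m))).
  exact: (differentiable_continuous (differentiable_co m z)).
rewrite /continuous_at /tens; elim: (index_enum _) => [|m s IH].
  by under eq_fun do rewrite big_nil; rewrite big_nil; exact: cvg_cst.
by under eq_fun do rewrite big_cons; rewrite big_cons; exact: (cvgM (c m) IH).
Qed.

(** The integral is iterated by definition, so Fubini is not involved: each level pulls out the
    factors that do not depend on its variable. *)
Lemma integral_spacetime_tens z0 e (g : 'I_4 -> R -> R) :
  (forall m, cont_supp (co z0 m) e (g m)) ->
  integral_spacetime (tens g) = \prod_m \int[mu]_s g m s.
Proof.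
move=> cg.
have I m (k : R) : \int[mu]_s (k * g m s) = k * \int[mu]_s g m s.
  by rewrite RintegralZl//; exact: cont_supp_integrable (cg m).
have E3 t a b : int3 (tens g) t a b =
    (g (ax 0) t * g (ax 1) a * \int[mu]_s g (ax 3) s) * g (ax 2) b.
  rewrite mulrAC -I; congr Rintegral; apply/funext => c.
  rewrite /tens 4!big_ord_recl big_ord0 mulr1 !co_point !mulrA.
  by congr (g _ _ * g _ _ * g _ _ * g _ _); apply: val_inj; rewrite /= inordK.
have E2 t a : int2 (tens g) t a =
    (g (ax 0) t * \int[mu]_s g (ax 2) s * \int[mu]_s g (ax 3) s) * g (ax 1) a.
  by rewrite /int2 (funext (E3 t a)) I; ring.
have E1 t : int1 (tens g) t = (\int[mu]_s g (ax 1) s *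
    \int[mu]_s g (ax 2) s * \int[mu]_s g (ax 3) s) * g (ax 0) t.
  by rewrite /int1 (funext (E2 t)) I; ring.
rewrite integral_spacetimeE (funext E1) I 4!big_ord_recl big_ord0 mulr1 mulrC !mulrA.
pose K m := \int[mu]_s g m s; rewrite -!/(K _).
by congr (K _ * K _ * K _ * K _); apply: val_inj; rewrite /= inordK.
Qed.

End BoxIntegral.

(** * A one-dimensional bump with explicit bounds and moments *)

Section Bump.
Variables (R : realType) (c e : R).
Hypothesis e0 : 0 < e.
Local Notation mu := (@lebesgue_measure R).

Definition bump_fun (s : R) : R :=
  flat 0 (1 + e^-1 * (s - c)) * flat 0 (1 - e^-1 * (s - c)).

(** The index 2 appears because the derivative of [flat 0] is [flat 2]. *)
Definition dbump_fun (s : R) : R :=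
  e^-1 * (flat 2 (1 + e^-1 * (s - c)) * flat 0 (1 - e^-1 * (s - c)) -
          flat 0 (1 + e^-1 * (s - c)) * flat 2 (1 - e^-1 * (s - c))).

Let dl1 (s : R) : is_derive s (1 : R) (fun s => 1 + e^-1 * (s - c)) e^-1.
Proof. by apply: is_derive_eq; rewrite /GRing.scale/=; ring. Qed.

Let dl2 (s : R) : is_derive s (1 : R) (fun s => 1 - e^-1 * (s - c)) (- e^-1).
Proof. by apply: is_derive_eq; rewrite /GRing.scale/=; ring. Qed.

Lemma is_derive_bump (s : R) : is_derive s (1 : R) bump_fun (dbump_fun s).
Proof.
have d1 := @is_derive1_comp _ _ (fun s => 1 + e^-1 * (s - c)) _ _ _
  (is_derive_flat 0 _) (dl1 s).
have d2 := @is_derive1_comp _ _ (fun s => 1 - e^-1 * (s - c)) _ _ _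
  (is_derive_flat 0 _) (dl2 s).
apply: (is_derive_eq (is_deriveM d1 d2)).
by rewrite /dbump_fun /GRing.scale/=; ring.
Qed.

Lemma continuous_flat n : continuous (@flat R n).
Proof.
move=> x; apply: differentiable_continuous; apply/derivable1_diffP.
by case: (is_derive_flat n x).
Qed.

Let cl1 n : continuous (fun s : R => flat n (1 + e^-1 * (s - c))).
Proof.
move=> s; apply: (@continuous_comp _ _ _ (fun s => 1 + e^-1 * (s - c))).
  by apply: differentiable_continuous; apply/derivable1_diffP; case: (dl1 s).
exact: continuous_flat.
Qed.

Let cl2 n : continuous (fun s : R => flat n (1 - e^-1 * (s - c))).
Proof.
move=> s; apply: (@continuous_comp _ _ _ (fun s => 1 - e^-1 * (s - c))).
  by apply: differentiable_continuous; apply/derivable1_diffP; case: (dl2 s).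
exact: continuous_flat.
Qed.

Let supp (s : R) : e < `|s - c| ->
  1 + e^-1 * (s - c) <= 0 \/ 1 - e^-1 * (s - c) <= 0.
Proof.
rewrite ltNge ler_distl negb_and -!ltNge => /orP[H|H]; [left|right].
  by rewrite mulrC addrC -lerBrDr sub0r ler_pdivrMr//; lra.
by rewrite subr_le0 mulrC ler_pdivlMr//; lra.
Qed.

Lemma cont_supp_bump : cont_supp c e bump_fun.
Proof.
split=> [s|s /supp[H|H]]; last 2 first.
- by rewrite /bump_fun (flat_eq0 _ H) mul0r.
- by rewrite /bump_fun (flat_eq0 _ H) mulr0.
by rewrite /continuous_at /bump_fun; apply: cvgM; [exact: cl1|exact: cl2].
Qed.

Lemma cont_supp_dbump : cont_supp c e dbump_fun.
Proof.
split=> [s|s /supp[H|H]]; last 2 first.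
- by rewrite /dbump_fun !(flat_eq0 _ H) !mul0r subrr mulr0.
- by rewrite /dbump_fun !(flat_eq0 _ H) !mulr0 subrr mulr0.
rewrite /continuous_at /dbump_fun; apply: cvgM; first exact: cvg_cst.
by apply: cvgB; apply: cvgM; [exact: cl1|exact: cl2|exact: cl1|exact: cl2].
Qed.

Lemma flat0_le1 (x : R) : flat 0 x <= 1.
Proof.
rewrite /flat; case: ifPn => // x0.
by rewrite expr0 mul1r -expR0 ler_expR oppr_le0 invr_ge0 ltW.
Qed.

Lemma bump_ge0 s : 0 <= bump_fun s.
Proof. by rewrite mulr_ge0 ?flat_ge0. Qed.

Lemma bump_le1 s : bump_fun s <= 1.
Proof. by rewrite -[1]mulr1 ler_pM ?flat_ge0 ?flat0_le1. Qed.

(** The two arguments add up to 2, so where both are positive each is at most 2. There [flat 2] is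
    at most [3! * 2 = 12] and [flat 0] at most 1, and the bracket is a difference of two numbers in
    [[0, 12]]. *)
Lemma dbump_le s : `|dbump_fun s| <= 12 * e^-1.
Proof.
set A := 1 + e^-1 * (s - c); set B := 1 - e^-1 * (s - c).
have AB : A + B = 2 by rewrite /A /B; ring.
rewrite /dbump_fun -/A -/B normrM gtr0_norm ?invr_gt0// mulrC ler_pM2r ?invr_gt0//.
have [A0|A0] := leP A 0; first by rewrite !(flat_eq0 _ A0) !mul0r subrr normr0.
have [B0|B0] := leP B 0; first by rewrite !(flat_eq0 _ B0) !mulr0 subrr normr0.
have F (x y : R) : 0 < x -> x <= 2 -> 0 <= flat 2 x * flat 0 y <= 12.
  move=> x0 x2; rewrite mulr_ge0 ?flat_ge0//=.
  apply: (@le_trans _ _ (12 * 1)); last by rewrite mulr1.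
  rewrite ler_pM ?flat_ge0 ?flat0_le1//.
  apply: (le_trans (flat_le 2 x0)).
  have -> : (3`!)%:R = 6 :> R by [].
  lra.
have A2 : A <= 2 by lra.
have B2 : B <= 2 by lra.
have /andP[a1 a2] := F _ B A0 A2; have /andP[b1 b2] := F _ A B0 B2.
rewrite (mulrC (flat 0 A)) ler_norml; apply/andP; split; lra.
Qed.

Lemma Rintegral_dbump : \int[mu]_s dbump_fun s = 0.
Proof.
apply: (Rintegral_supp_derive e0 cont_supp_bump _ is_derive_bump).
exact: cont_supp_dbump.1.
Qed.

Lemma cont_suppM (f g : R -> R) : continuous f -> cont_supp c e g ->
  cont_supp c e (fun s => f s * g s).
Proof.
move=> cf [cg g0]; split=> [s|s Hs]; first exact: (cvgM (cf s) (cg s)).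
by rewrite g0// mulr0.
Qed.

Let csub : continuous (fun s : R => s - c).
Proof. by move=> s; exact: (cvgB cvg_id (cvg_cst c)). Qed.

(** Integration by parts: [(s - c) * bump_fun s] has compact support, so its derivative, the sum of
    the two integrands, has integral 0. *)
Lemma Rintegral_Mdbump :
  \int[mu]_s ((s - c) * dbump_fun s) = - \int[mu]_s bump_fun s.
Proof.
apply/eqP; rewrite -addr_eq0; apply/eqP.
have c1 := cont_suppM csub cont_supp_dbump.
rewrite -RintegralD//; [|exact: cont_supp_integrable c1|
  exact: cont_supp_integrable cont_supp_bump].
apply: (Rintegral_supp_derive e0 (cont_suppM csub cont_supp_bump)).
  by move=> s; exact: (cvgD (c1.1 s) (cont_supp_bump.1 s)).
move=> s; have d := is_derive_bump s.
apply: (is_derive_eq (is_deriveM (is_deriveB (is_derive_id s 1) (is_derive_cst c s 1)) d)).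
by rewrite subr0 /GRing.scale/= mulr1.
Qed.

(** On the concentric interval of length [e] both arguments of [flat 0] are at least 1/2, so each
    factor is at least [exp (-2)]. *)
Lemma Rintegral_bump_ge : expR (- 4) * e <= \int[mu]_s bump_fun s.
Proof.
pose D := `[c - e / 2, c + e / 2]%classic : set R.
have mD : measurable D by exact: measurable_itv.
have -> : expR (- 4) * e = \int[mu]_s ((cst (expR (- 4)) \_ D) s).
  rewrite -Rintegral_mkcond Rintegral_cst//; congr (_ * _).
  have -> : e = fine e%:E by [].
  congr fine; apply: esym; apply: etrans (lebesgue_measure_itv _) _.
  by rewrite /= lte_fin ltrD2l gtrN ?divr_gt0// -EFinD; congr EFin; field.
apply: le_Rintegral => //.
- rewrite -restrict_EFin.
  apply: (@integrable_mkcond _ _ _ mu _ (EFin \o cst (expR (- 4))) mD).1.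
  apply: continuous_compact_integrable; first exact: segment_compact.
  by apply: continuous_subspaceT => ?; exact: cst_continuous.
- exact: cont_supp_integrable cont_supp_bump.
move=> s _; rewrite /patch; case: ifPn => [|_]; last exact: bump_ge0.
rewrite inE /D /= in_itv/= -ler_distl => H.
have E2 (x : R) : 2^-1 <= x -> expR (- 2) <= flat 0 x.
  move=> x2; have x0 : 0 < x by apply: lt_le_trans x2; rewrite invr_gt0.
  by rewrite /flat x0 expr0 mul1r ler_expR lerN2 -[2]invrK lef_pV2// posrE invr_gt0.
have -> : - 4 = - 2 - 2 :> R by lra.
have He : `|e^-1 * (s - c)| <= 2^-1.
  by rewrite normrM gtr0_norm ?invr_gt0// mulrC ler_pdivrMr// mulrC.
move: He; rewrite ler_norml => /andP[H1 H2].
by rewrite expRD ler_pM ?expR_ge0// E2//; lra.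
Qed.

End Bump.

(** * From the weak to the pointwise equations *)

Lemma near_norm_ball (R : realType) (V : normedModType R) (x : V) (P : set V) :
  (\forall y \near x, P y) -> exists2 d, 0 < d & forall y, `|y - x| < d -> P y.
Proof.
move=> /nbhs_ballP[d /= d0 H]; exists d => // y yx; apply: H.
by rewrite -ball_normE /= distrC.
Qed.

Lemma differentiable_taylor (R : realType) (V W : normedModType R) (f : V -> W)
    (x : V) (e : R) : differentiable f x -> 0 < e ->
  \forall y \near x, `|f y - f x - 'd f x (y - x)| <= e * `|y - x|.
Proof.
move=> df e0; have H := diff_locally df.
have /eqaddoP/(_ e e0) := H.
rewrite (near_shift 0) subr0.
by apply: filterS => y /=; rewrite addrK opprD addrA.
Qed.

Lemma derive_line (R : realType) (V W : normedModType R) (f : V -> W) (x v : V)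
    (d : W) :
  is_derive (0 : R) (1 : R) (fun h => f (h *: v + x)) d -> 'D_v f x = d.
Proof.
move=> [_ <-]; rewrite /derive.
have -> : (fun h : R => h^-1 *: ((f \o shift x) (h *: v) - f x)) =
  (fun h : R => h^-1 *: (((fun h => f (h *: v + x)) \o shift 0) (h *: (1 : R)) -
    f (0 *: v + x))) => //.
by apply/funext => h /=; rewrite scale0r add0r addr0 (_ : h%:A = h)//; exact: mulr1.
Qed.

(** * The product bump as a test function, and the moments of its partial derivatives *)

Section BumpTest.
Variables (R : realType) (z0 : spacetime R) (e : R).
Hypothesis e0 : 0 < e.
Local Notation mu := (@lebesgue_measure R).

Definition test_bump : spacetime R -> R := tens (fun m => bump_fun (co z0 m) e).

Definition dbump_fam (m n : 'I_4) : R -> R :=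
  if n == m then dbump_fun (co z0 n) e else bump_fun (co z0 n) e.

Definition dtest_bump (m : 'I_4) : spacetime R -> R := tens (dbump_fam m).

Definition bump_mass : R := \prod_m \int[mu]_s bump_fun (co z0 m) e s.

Lemma cont_supp_dbump_fam m n : cont_supp (co z0 n) e (dbump_fam m n).
Proof.
by rewrite /dbump_fam; case: ifP => _; [exact: cont_supp_dbump|exact: cont_supp_bump].
Qed.

Lemma test_bump_smooth : smooth test_bump.
Proof.
apply: flat_expr_smooth; rewrite /test_bump /tens.
elim: (index_enum _) => [|m s IH].
  have -> : (fun z => \prod_(i <- [::]) bump_fun (co z0 i) e (co z i)) =
      cst 1 :> (spacetime R -> R).
    by apply/funext => z; rewrite big_nil.
  exact: flat_expr_cst.
pose l (k : R) (z : spacetime R) := 1 + k * (co z m - co z0 m).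
have dl k z : differentiable (l k) z.
  apply: differentiableD; first exact: differentiable_cst.
  apply: differentiableM; first exact: differentiable_cst.
  apply: differentiableB; last exact: differentiable_cst.
  exact: differentiable_co.
have cl k v : exists c, forall z, 'D_v (l k) z = c.
  exists (k * co v m) => z.
  have dc : is_derive z v (fun z => co z m) (co v m).
    apply: DeriveDef; last exact: derive_co.
    exact/diff_derivable/differentiable_co.
  have d1 := is_deriveB dc (is_derive_cst (co z0 m) z v).
  have [_ E] := is_deriveD (is_derive_cst (1 : R) z v) (is_deriveZ k d1).
  rewrite -[LHS]/('D_v (cst 1 + k \*: ((fun z => co z m) - cst (co z0 m))) z) E.
  by rewrite add0r subr0.
have -> : (fun z => \prod_(i <- m :: s) bump_fun (co z0 i) e (co z i)) =
  ((flat 0 \o l e^-1) * (flat 0 \o l (- e^-1))) *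
  (fun z => \prod_(i <- s) bump_fun (co z0 i) e (co z i)).
  by apply/funext => z; rewrite big_cons /bump_fun -mulNr.
apply: flat_exprM => //; apply: flat_exprM; exact: flat_expr_flat.
Qed.

Lemma test_bump_box z : test_bump z != 0 -> forall m, `|co z m - co z0 m| <= e.
Proof.
move=> H m; rewrite leNgt; apply: contra H => H; apply/eqP.
by apply: (boxed_tens _).2 H => n; exact: cont_supp_bump.
Qed.

Lemma test_bump_test (T : R) : e < z0.1 -> z0.1 + e < T -> test_function T test_bump.
Proof.
move=> z01 z02.
pose K : set (spacetime R) := `[z0.1 - e, z0.1 + e]%classic `*`
  [set x : 'rV[R]_3 | forall i, `[z0.2 0 i - e, z0.2 0 i + e]%classic (x 0 i)].
have cK : compact K.
  apply: compact_setX; first exact: segment_compact.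
  apply: (@rV_compact _ _ (fun i => `[z0.2 0 i - e, z0.2 0 i + e]%classic)) => i.
  exact: segment_compact.
have SK : closure [set z | test_bump z != 0] `<=` K.
  have clK : closed K by apply: compact_closed => //; exact: norm_hausdorff.
  rewrite ((closure_id K).1 clK); apply: closure_subset => z /test_bump_box H.
  split => [|i] /=; rewrite in_itv/= -ler_distl.
    by have := H ord0; rewrite !co0.
  by have := H (lift ord0 i); rewrite !coS.
split; first exact: test_bump_smooth.
- by apply: subclosed_compact cK SK; exact: closed_closure.
- by move=> z /SK [/= +  _]; rewrite in_itv/= => /andP[H1 H2]; apply/andP; split; lra.
Qed.

Lemma derive_test_bump m z : 'D_(dir R m) test_bump z = dtest_bump m z.
Proof.
apply: derive_line.
have E : (fun h : R => test_bump (h *: dir R m + z)) =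
  (\prod_(n | n != m) bump_fun (co z0 n) e (co z n)) \*:
    (bump_fun (co z0 m) e \o (fun h => h + co z m)).
  apply/funext => h; rewrite /test_bump /tens (bigD1 m)//= mulrC.
  rewrite coD coZ co_dir eqxx mulr1; congr (_ * _).
  by apply: eq_bigr => n nm; rewrite coD coZ co_dir (negbTE nm) mulr0 add0r.
rewrite E.
have d1 := is_deriveD (is_derive_id (0 : R) 1) (is_derive_cst (co z m) (0 : R) 1).
have d2 := is_derive1_comp (is_derive_bump (co z0 m) e ((id + cst (co z m)) (0 : R))) d1.
apply: (is_derive_eq (is_deriveZ _ d2)).
rewrite /dtest_bump /tens [RHS](bigD1 m)//= /dbump_fam eqxx addr0 mulr1 /GRing.scale/= mulrC.
rewrite -[_ 0]/(0 + co z m) add0r; congr (_ * _).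
by apply: eq_bigr => n nm; rewrite (negbTE nm).
Qed.

Lemma dtest_bump_le m z : `|dtest_bump m z| <= 12 * e^-1.
Proof.
rewrite /dtest_bump /tens (bigD1 m)//= normrM /dbump_fam eqxx.
rewrite -[leRHS]mulr1; apply: ler_pM => //; first exact: dbump_le.
rewrite normr_prod; apply: prodr_ile1 => n nm.
by rewrite (negbTE nm) normr_ge0/= ger0_norm ?bump_ge0// bump_le1.
Qed.

Lemma bump_mass_ge : (expR (- 4) * e) ^+ 4 <= bump_mass.
Proof.
have -> : (expR (- 4) * e) ^+ 4 = \prod_(m < 4) (expR (- 4) * e).
  by rewrite prodr_const card_ord.
apply: ler_prod => m _; rewrite mulr_ge0 ?expR_ge0 ?(ltW e0)//=.
exact: Rintegral_bump_ge.
Qed.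

Lemma integral_dtest_bump m : integral_spacetime (dtest_bump m) = 0.
Proof.
rewrite (integral_spacetime_tens (e := e) (z0 := z0)); last exact: cont_supp_dbump_fam.
by rewrite (bigD1 m)//= /dbump_fam eqxx Rintegral_dbump// mul0r.
Qed.

(* the factors of the tensor product (z_n - z0_n) * dtest_bump m *)
Definition lin_fam (m n k : 'I_4) (s : R) : R :=
  (if k == n then s - co z0 k else 1) * dbump_fam m k s.

Lemma lin_famE m n z :
  (co z n - co z0 n) * dtest_bump m z = tens (lin_fam m n) z.
Proof.
rewrite /tens /lin_fam big_split/=; congr (_ * _).
rewrite (bigD1 n)//= eqxx big1 ?mulr1// => i ni.
by rewrite (negbTE ni).
Qed.

Lemma cont_supp_lin_fam m n k : cont_supp (co z0 k) e (lin_fam m n k).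
Proof.
apply: cont_suppM; last exact: cont_supp_dbump_fam.
case: (k == n) => s; first exact: (cvgB cvg_id (cvg_cst _)).
exact: cst_continuous.
Qed.

(** For [n != m] the factor in variable [m] is still a bare derivative of a bump, with integral 0;
    for [n = m] that factor is the first moment, which is minus the integral of the bump. Against an
    affine function a derivative of the bump therefore sees exactly one slope. *)
Lemma integral_lin_dtest_bump m n :
  integral_spacetime (fun z => (co z n - co z0 n) * dtest_bump m z) =
  if n == m then - bump_mass else 0.
Proof.
rewrite (funext (lin_famE m n)).
rewrite (integral_spacetime_tens (e := e) (z0 := z0)); last exact: cont_supp_lin_fam.
rewrite (bigD1 m)//= /lin_fam /dbump_fam eqxx [m == n]eq_sym.
case: ifPn => [/eqP ->|_]; last first.
  by under eq_Rintegral do rewrite mul1r; rewrite Rintegral_dbump// mul0r.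
rewrite Rintegral_Mdbump// /bump_mass [in RHS](bigD1 m)//= mulNr; congr (- (_ * _)).
apply: eq_bigr => i im; rewrite (negbTE im).
by under eq_Rintegral do rewrite mul1r.
Qed.

End BumpTest.

Lemma diff_co (R : realType) (f : spacetime R -> R) (z w : spacetime R) :
  differentiable f z -> 'd f z w = \sum_m co w m * 'D_(dir R m) f z.
Proof.
move=> df; rewrite {1}(co_sum w) linear_sum; apply: eq_bigr => m _.
by rewrite linearZ /= deriveE.
Qed.

Lemma derive_co_sum (R : realType) (f : spacetime R -> R) (z w : spacetime R) :
  differentiable f z -> 'D_w f z = \sum_m co w m * 'D_(dir R m) f z.
Proof. by move=> df; rewrite deriveE// diff_co. Qed.

(** The fluxes are controlled only near [z0], so [f] may be discontinuous away from it. Outside the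
    closed box some coordinate exceeds [e] on a whole neighbourhood, so [g] and the product vanish
    there. *)
Lemma continuous_box (R : realType) (z0 : spacetime R) (e : R)
    (f g : spacetime R -> R) :
  boxed z0 e g -> (forall z, `|z - z0| <= e -> {for z, continuous f}) ->
  0 <= e -> boxed z0 e (fun z => f z * g z).
Proof.
move=> bg cf e0; split=> [z|z m H]; last by rewrite (bg.2 z m H) mulr0.
have [H|/existsNP[m /negP]] := pselect (forall m, `|co (z - z0) m| <= e).
  by apply: cvgM; [apply: cf; exact: norm_le_co|exact: bg.1].
rewrite -ltNge coB => H.
have nE : \forall y \near z, 0 = f y * g y.
  have cz : {for z, continuous (fun y => `|co y m - co z0 m|)}.
    apply: continuous_comp; last exact: norm_continuous.
    apply: continuousB; last exact: cst_continuous.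
    exact: (differentiable_continuous (differentiable_co m z)).
  near=> y; rewrite (bg.2 y m) ?mulr0//; near: y.
  exact: (cvgr_gt _ cz).
have : cst (0 : R) y @[y --> z] --> f z * g z.
  by rewrite (bg.2 z m H) mulr0; exact: cvg_cst.
by apply: cvg_trans; apply: near_eq_cvg.
Unshelve. all: by end_near.
Qed.

(* Integration by parts is only applied to the affine Taylor polynomial of f at
   z0; the remainder contributes o(e) * (12 / e) * (2 e)^4 = o(e^4), whereas
   bump_mass is of order e^4. *)
Lemma dtest_bump_estimate (R : realType) (z0 : spacetime R) (f : spacetime R -> R)
    (m : 'I_4) (eta : R) :
  0 < eta -> (\forall z \near z0, {for z, continuous f}) ->
  differentiable f z0 ->
  exists2 d, 0 < d & forall e, 0 < e -> e < d ->
    boxed z0 e (fun z => f z * dtest_bump z0 e m z) /\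
    `|integral_spacetime (fun z => f z * dtest_bump z0 e m z) +
      'D_(dir R m) f z0 * bump_mass z0 e| <= 12 * 2 ^+ 4 * eta * e ^+ 4.
Proof.
move=> eta0 cf df.
have [d d0 H] := near_norm_ball (filterI cf (differentiable_taylor df eta0)).
exists d => // e e0 ed.
have cfe z : `|z - z0| <= e -> {for z, continuous f}.
  by move=> ze; apply: (H z _).1; exact: le_lt_trans ed.
have bd : boxed z0 e (dtest_bump z0 e m).
  by apply: boxed_tens => n; exact: cont_supp_dbump_fam.
have bf : boxed z0 e (fun z => f z * dtest_bump z0 e m z).
  by apply: continuous_box => //; exact: ltW.
split=> //.
pose r z := f z - f z0 - 'd f z0 (z - z0).
pose G z := r z * dtest_bump z0 e m z.
pose L n z := 'D_(dir R n) f z0 * ((co z n - co z0 n) * dtest_bump z0 e m z).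
have bL0 n : boxed z0 e (fun z => (co z n - co z0 n) * dtest_bump z0 e m z).
  rewrite (funext (lin_famE z0 e m n)); apply: boxed_tens => k.
  exact: cont_supp_lin_fam.
have bL n : boxed z0 e (L n) by exact: boxedZ.
have b0 : boxed z0 e (fun z => f z0 * dtest_bump z0 e m z) by exact: boxedZ.
have bS : boxed z0 e (fun z => \sum_n L n z) by exact: boxed_sum.
have bG : boxed z0 e G.
  have -> : G = (fun z => f z * dtest_bump z0 e m z) \+
     (fun z => -1 * ((fun z => f z0 * dtest_bump z0 e m z) \+
       (fun z => \sum_n L n z)) z).
    apply/funext => z; rewrite /G /r /L /= diff_co//.
    under [in RHS]eq_bigr do rewrite mulrA.
    rewrite -mulr_suml.
    under [in LHS]eq_bigr do rewrite coB mulrC.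
    ring.
  by apply: boxedD => //; apply: boxedZ; apply: boxedD.
have E : (fun z => f z * dtest_bump z0 e m z) =
   ((fun z => f z0 * dtest_bump z0 e m z) \+ (fun z => \sum_n L n z)) \+ G.
  apply/funext => z; rewrite /G /r /L /= diff_co//.
  under [in RHS]eq_bigr do rewrite mulrA.
  rewrite -mulr_suml.
  under [in X in _ - X]eq_bigr do rewrite coB mulrC.
  ring.
have IL n : integral_spacetime (L n) =
    if n == m then - ('D_(dir R m) f z0 * bump_mass z0 e) else 0.
  rewrite /L (integral_spacetimeZ _ e0 (bL0 n)) integral_lin_dtest_bump//.
  by case: eqP => [->|_]; rewrite ?mulr0 ?mulrN.
rewrite E (integral_spacetimeD e0 (boxedD b0 bS) bG).
rewrite (integral_spacetimeD e0 b0 bS) (integral_spacetimeZ _ e0 bd).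
rewrite integral_dtest_bump// mulr0 add0r (integral_spacetime_sum _ e0 bL).
rewrite (eq_bigr _ (fun n _ => IL n)) -big_mkcond big_pred1_eq.
rewrite addrAC addNr add0r.
have Gle z : `|G z| <= 12 * eta.
  have [ze|/existsNP[n /negP]] := pselect (forall m, `|co (z - z0) m| <= e); last first.
    rewrite -ltNge coB => zn; rewrite (bG.2 z n zn) normr0.
    by rewrite mulr_ge0// ltW.
  have {}ze := norm_le_co (ltW e0) ze.
  rewrite normrM; apply: (@le_trans _ _ ((eta * e) * (12 * e^-1))).
    apply: ler_pM => //; last exact: dtest_bump_le.
    apply: le_trans (H z _).2 _; first exact: le_lt_trans ed.
    by rewrite ler_pM2l.
  by rewrite mulrACA divff ?gt_eqF// mulr1 mulrC.
have -> : 12 * 2 ^+ 4 * eta * e ^+ 4 = (12 * eta) * (e *+ 2) ^+ 4.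
  by rewrite -(mulr_natl e) exprMn; ring.
apply: (integral_spacetime_bound e0 bG) => //.
by rewrite mulr_ge0// ltW.
Qed.

(** Testing with a bump of radius [e] shows that the divergence times [bump_mass] is at most a
    constant times [eta * e^4]. As [bump_mass] is at least a positive constant times [e^4], the
    powers of [e] cancel, and [eta] is arbitrary. *)
Lemma conservation_law_pointwise (R : realType) (T : R) (a : spacetime R -> R)
    (b : spacetime R -> 'rV[R]_3) (z0 : spacetime R) :
  conservation_law T a b -> 0 < z0.1 < T ->
  (\forall z \near z0, {for z, continuous a}) -> differentiable a z0 ->
  (forall j, \forall z \near z0, {for z, continuous (fun z => b z 0 j)}) ->
  (forall j, differentiable (fun z => b z 0 j) z0) ->
  'D_(1, 0) a z0 + \sum_j 'D_(0, delta_mx 0 j) (fun z => b z 0 j) z0 = 0.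
Proof.
move=> cl /andP[z0_gt0 z0_ltT] ca da cb db.
pose f (m : 'I_4) z := oapp (fun j => b z 0 j) (a z) (unlift ord0 m).
have f0 : f ord0 = a by apply/funext => z; rewrite /f unlift_none.
have fS j : f (lift ord0 j) = (fun z => b z 0 j).
  by apply/funext => z; rewrite /f liftK.
have cf m : \forall z \near z0, {for z, continuous (f m)}.
  by case: (unliftP ord0 m) => [j ->|->]; rewrite ?f0 ?fS.
have df m : differentiable (f m) z0.
  by case: (unliftP ord0 m) => [j ->|->]; rewrite ?f0 ?fS.
pose A := \sum_m 'D_(dir R m) (f m) z0.
have -> : 'D_(1, 0) a z0 + \sum_j 'D_(0, delta_mx 0 j) (fun z => b z 0 j) z0 = A.
  rewrite /A [RHS]big_ord_recl f0 dir0; congr (_ + _).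
  by apply: eq_bigr => j _; rewrite fS dirS.
pose k := expR (- 4 : R) ^+ 4.
have k0 : 0 < k by rewrite exprn_gt0// expR_gt0.
(* One error [12 * 2^4 * eta * e^4] for each of the four coordinate directions. *)
have [K K0 KE] : exists2 K : R, 0 < K & K = 4 * (12 * 2 ^+ 4).
  by exists (4 * (12 * 2 ^+ 4)) => //; rewrite !mulr_gt0// exprn_gt0.
suff AE eta : 0 < eta -> `|A| * k <= K * eta.
  apply/eqP; rewrite -normr_le0 -(ler_pM2r k0) mul0r.
  apply/ler_addgt0Pr => eta eta0; rewrite add0r.
  have eta1 : 0 < eta / K by rewrite divr_gt0.
  by apply: (le_trans (AE _ eta1)); rewrite mulrC divfK// gt_eqF.
move=> eta0.
have [d d0 dP] : exists2 d, 0 < d & forall e, 0 < e -> e < d -> forall m,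
    boxed z0 e (fun z => f m z * dtest_bump z0 e m z) /\
    `|integral_spacetime (fun z => f m z * dtest_bump z0 e m z) +
      'D_(dir R m) (f m) z0 * bump_mass z0 e| <= 12 * 2 ^+ 4 * eta * e ^+ 4.
  have /choice[d dP] : forall m, exists d, 0 < d /\ forall e, 0 < e -> e < d ->
    boxed z0 e (fun z => f m z * dtest_bump z0 e m z) /\
    `|integral_spacetime (fun z => f m z * dtest_bump z0 e m z) +
      'D_(dir R m) (f m) z0 * bump_mass z0 e| <= 12 * 2 ^+ 4 * eta * e ^+ 4.
    move=> m; have [d d0 dP] := dtest_bump_estimate m eta0 (cf m) (df m).
    by exists d.
  exists (\big[Num.min/1]_m d m).
    by apply/bigmin_gtP; split=> // m _; exact: (dP m).1.
  move=> e e0 /bigmin_gtP[_ ed] m; apply: (dP m).2 => //; exact: ed.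
(* The halves make the inequalities strict: the closed box must lie inside the open time
   interval. *)
pose e := Num.min (d / 2) (Num.min (z0.1 / 2) ((T - z0.1) / 2)).
have [e0 e1 e2 e3] : [/\ 0 < e, e < d, e < z0.1 & z0.1 + e < T].
  split.
  - by rewrite !lt_min !divr_gt0// subr_gt0.
  - by apply: (@le_lt_trans _ _ (d / 2)); [rewrite ge_min lexx|lra].
  - by apply: (@le_lt_trans _ _ (z0.1 / 2)); [rewrite !ge_min lexx orbT|lra].
  - rewrite -ltrBrDl; apply: (@le_lt_trans _ _ ((T - z0.1) / 2)); last lra.
    by rewrite !ge_min lexx !orbT.
have := cl _ (test_bump_test e0 e2 e3).
have -> : (fun z => a z * 'D_(1, 0) (test_bump z0 e) z +
    \sum_(j < 3) b z 0 j * 'D_(0, delta_mx 0 j) (test_bump z0 e) z) =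
    (fun z => \sum_m f m z * dtest_bump z0 e m z).
  apply/funext => z; rewrite [RHS]big_ord_recl f0 -(derive_test_bump z0 e ord0 z) dir0.
  congr (_ + _).
  apply: eq_bigr => j _; rewrite fS; congr (_ * _).
  by rewrite -(derive_test_bump z0 e (lift ord0 j) z) dirS.
have P := dP e e0 e1.
rewrite (integral_spacetime_sum _ e0 (fun m => (P m).1)) => S0.
have AB : `|A * bump_mass z0 e| <= K * eta * e ^+ 4.
  rewrite -[_ * _]add0r -S0 /A mulr_suml -big_split/=.
  apply: le_trans (ler_norm_sum _ _ _) _.
  have -> : K * eta * e ^+ 4 = \sum_(m < 4) (12 * 2 ^+ 4 * eta * e ^+ 4).
    by rewrite sumr_const card_ord KE; ring.
  by apply: ler_sum => m _; exact: (P m).2.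
have := bump_mass_ge z0 e0; rewrite exprMn -/k => kB.
have e4 : 0 < e ^+ 4 by rewrite exprn_gt0.
rewrite -(ler_pM2r e4) -mulrA; apply: le_trans AB.
rewrite normrM ler_wpM2l//; apply: le_trans kB _; exact: ler_norm.
Qed.

(** * Solutions of class C^1 on a slab *)

Lemma is_derive_line (R : realType) (V W : normedModType R) (f : V -> W)
    (z v : V) (s : R) :
  derivable f (z + s *: v) v ->
  is_derive s (1 : R) (fun s => f (z + s *: v)) ('D_v f (z + s *: v)).
Proof.
have E : (fun h : R => h^-1 *: (((fun s => f (z + s *: v)) \o shift s) (h *: (1 : R)) -
    f (z + s *: v))) =
  (fun h : R => h^-1 *: ((f \o shift (z + s *: v)) (h *: v) - f (z + s *: v))).
  apply/funext => h /=; rewrite (_ : h%:A = h); last exact: mulr1.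
  by rewrite scalerDl addrCA.
by move=> df; apply: DeriveDef; rewrite /derivable /derive E.
Qed.

Lemma MVT_line (R : realType) (V : normedModType R) (f : V -> R) (z v : V) (c : R) :
  (forall s, `|s| <= `|c| -> derivable f (z + s *: v) v) ->
  exists2 s, `|s| <= `|c| & f (z + c *: v) - f z = c * 'D_v f (z + s *: v).
Proof.
move=> df; pose g (s : R) := f (z + s *: v).
pose dg (s : R) := 'D_v f (z + s *: v).
have dgP s : `|s| <= `|c| -> is_derive s (1 : R) g (dg s).
  by move=> /df; exact: is_derive_line.
have cg s : `|s| <= `|c| -> {for s, continuous g}.
  move=> /dgP[dgs _]; apply: differentiable_continuous.
  exact/derivable1_diffP.
have g0 : g 0 = f z by rewrite /g scale0r addr0.
have [c0|c0] := leP 0 c.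
- have sc s : s \in `[0, c]%R -> `|s| <= `|c|.
    by rewrite in_itv/= => /andP[s0 s1]; rewrite !ger0_norm.
  have [||s sI E] := @MVT_segment R g dg 0 c c0.
  + by move=> s /subset_itv_oo_cc/sc/dgP.
  + by apply: continuous_in_subspaceT => s /[!inE] /sc/cg.
  by exists s; [exact: sc|rewrite -g0 -/(g c) E subr0 mulrC].
- have sc s : s \in `[c, 0]%R -> `|s| <= `|c|.
    by rewrite in_itv/= => /andP[s0 s1]; rewrite !ler0_norm ?lerN2// ltW.
  have [||s sI E] := @MVT_segment R g dg c 0 (ltW c0).
  + by move=> s /subset_itv_oo_cc/sc/dgP.
  + by apply: continuous_in_subspaceT => s /[!inE] /sc/cg.
  exists s; first exact: sc.
  by rewrite -g0 -opprB -[_ - g c]/(g 0 - g c) E sub0r mulrN opprK mulrC.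
Qed.

Lemma normr_dir (R : realType) m : `|dir R m| <= 1.
Proof.
by apply: norm_le_co => // n; rewrite co_dir; case: eqP; rewrite ?normr1 ?normr0.
Qed.

(** The increment is made one coordinate at a time, with the mean value theorem on each leg. The
    list [s] of directions is arbitrary so that induction applies, and its size bounds both the
    number of errors and the length of the detour. *)
Lemma telescope_partials (R : realType) (f : spacetime R -> R) (z h : spacetime R)
    (A : 'I_4 -> R) (eta : R) (s : seq 'I_4) : 0 <= eta ->
  (forall y, `|y - z| <= (size s)%:R * `|h| -> forall m,
     derivable f y (dir R m) /\ `|'D_(dir R m) f y - A m| <= eta) ->
  `|f (z + \sum_(m <- s) co h m *: dir R m) - f z - \sum_(m <- s) co h m * A m|
    <= (size s)%:R * (eta * `|h|).
Proof.
move=> eta0; elim: s => [|m s IH] H.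
  by rewrite !big_nil addr0 subrr subr0 normr0 mul0r.
have hm := normr_co_le h m.
have step k : `|k *: dir R m| <= `|k|.
  by rewrite normrZ -[leRHS]mulr1 ler_wpM2l// normr_dir.
have ps : `|\sum_(m <- s) co h m *: dir R m| <= (size s)%:R * `|h|.
  elim: (s) => [|n s' IH']; first by rewrite big_nil normr0 mul0r.
  rewrite big_cons /= -nat1r mulrDl mul1r; apply: le_trans (ler_normD _ _) _.
  rewrite lerD//; rewrite normrZ -[leRHS]mulr1 ler_pM ?normr_dir//.
  exact: normr_co_le.
set p := \sum_(m <- s) _ in ps *.
have H' k : `|k| <= `|co h m| -> derivable f (z + p + k *: dir R m) (dir R m) /\
    `|'D_(dir R m) f (z + p + k *: dir R m) - A m| <= eta.
  move=> kh; apply: H => /=; rewrite -(addrA z) [_ - z]addrC addKr.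
  rewrite -natr1 mulrDl mul1r; apply: le_trans (ler_normD _ _) _; rewrite lerD//.
  by apply: le_trans (step k) _; apply: le_trans hm.
have [k kh E] := MVT_line (fun k kh => (H' k kh).1).
rewrite !big_cons -/p.
have -> : f (z + (co h m *: dir R m + p)) - f z -
    (co h m * A m + \sum_(n <- s) co h n * A n) =
  (f (z + p + co h m *: dir R m) - f (z + p) - co h m * A m) +
  (f (z + p) - f z - \sum_(n <- s) co h n * A n).
  by rewrite (addrC _ p) addrA; ring.
rewrite E -mulrBr /= -nat1r mulrDl mul1r; apply: le_trans (ler_normD _ _) _.
rewrite lerD//.
  by rewrite normrM mulrC ler_pM//; exact: (H' k kh).2.
apply: IH => y yz; apply: H; apply: le_trans yz _.
by rewrite ler_wpM2r// ler_nat.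
Qed.

Lemma differentiable_of_littleo (R : realType) (V W : normedModType R) (f : V -> W)
    (x : V) (L : {linear V -> W}) : continuous L ->
  (forall eta : R, 0 < eta ->
    \forall h \near (0 : V), `|f (h + x) - (f x + L h)| <= eta * `|h|) ->
  differentiable f x.
Proof.
move=> cL H; have E : f \o shift x = cst (f x) + L +o_ 0 id.
  by apply/eqaddoP => eta eta0; exact: H.
by apply/diff_locallyP; rewrite (diff_unique cL E).
Qed.

(** Continuity at [z] keeps all four partials within [eta / 4] of their values at [z] on a ball; the
    four legs of the telescoping sum then cost [eta] in total. This turns the definition of
    [C1_slab] by partials into differentiability. *)
Lemma differentiable_partials (R : realType) (f : spacetime R -> R) (z : spacetime R) :
  (forall m, \forall y \near z, derivable f y (dir R m)) ->
  (forall m, {for z, continuous (fun y => 'D_(dir R m) f y)}) ->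
  differentiable f z.
Proof.
move=> df cf; pose A m := 'D_(dir R m) f z.
pose L w := \sum_m co w m * A m.
have Llin : linear L.
  move=> k u v; rewrite /L /GRing.scale/= mulr_sumr -big_split/=.
  by apply: eq_bigr => m _; rewrite coD coZ; ring.
pose LM := GRing.isLinear.Build _ _ _ _ _ Llin.
pose LL : {linear spacetime R -> R} := HB.pack L LM.
have cL : continuous L.
  move=> w; apply: differentiable_continuous.
  have -> : L = \sum_(m < 4) (fun w => co w m * A m).
    by apply/funext => y; rewrite /L fct_sumE.
  apply: differentiable_sum => m; apply: differentiableM; first exact: differentiable_co.
  exact: differentiable_cst.
apply: (@differentiable_of_littleo _ _ _ f z LL) => // eta eta0.
have eta1 : 0 < eta / 4 by rewrite divr_gt0.
have nP : \forall y \near z, forall m, derivable f y (dir R m) /\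
   `|'D_(dir R m) f y - A m| <= eta / 4.
  have nm m : \forall y \near z, derivable f y (dir R m) /\
      `|'D_(dir R m) f y - A m| <= eta / 4.
    apply: filterI; first exact: df.
    have /cvgrPdist_le/(_ _ eta1) := cf m.
    by apply: filterS => y; rewrite distrC.
  refine (@filter_forall _ _ _ _ _ nm).
have [d d0 dP] := near_norm_ball nP.
near=> h.
have hd : 4 * `|h| < d.
  have : ball 0 (d / 4) h by near: h; apply: nbhsx_ballx; rewrite divr_gt0.
  by rewrite -ball_normE /= sub0r normrN ltr_pdivlMr// mulrC.
have := @telescope_partials R f z h A (eta / 4) (index_enum _) (ltW eta1).
have -> : size (index_enum 'I_4) = 4%N by rewrite -[RHS](card_ord 4) cardT enumT.
rewrite -co_sum mulrA mulrCA divff// mulr1 => TP.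
rewrite /= opprD addrA (addrC h); apply: TP => y yz m.
by apply: dP; apply: le_lt_trans hd.
Unshelve. all: by end_near.
Qed.

Section C1Slab.
Variables (R : realType) (T : R).
Implicit Types (z : spacetime R).

Lemma open_slab : open [set z : spacetime R | 0 < z.1 < T].
Proof.
have -> : [set z : spacetime R | 0 < z.1 < T] = fst @^-1` `]0, T[%classic.
  by apply/seteqP; split=> z /=; rewrite in_itv.
by apply: open_comp; [move=> z _; exact: cvg_fst|exact: interval_open].
Qed.

Lemma near_slab z : 0 < z.1 < T -> \forall y \near z, 0 < y.1 < T.
Proof. by move=> zT; apply: open_nbhs_nbhs; split; [exact: open_slab|]. Qed.

Lemma slab_continuous_at (W : topologicalType) (f : spacetime R -> W) z :
  {within slab T, continuous f} -> 0 < z.1 < T -> {for z, continuous f}.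
Proof.
move=> cf zT; have : {within [set z : spacetime R | 0 < z.1 < T], continuous f}.
  by apply: continuous_subspaceW cf => y /= /andP[y0 yT]; rewrite /slab/= !ltW.
rewrite continuous_open_subspace; last exact: open_slab.
by apply; rewrite inE.
Qed.

(** At an interior time every small increment is admissible, so [time_incr] is the full punctured
    neighbourhood filter. *)
Lemma slab_derive_time (W : normedModType R) (f : spacetime R -> W) z :
  0 < z.1 < T -> cvg (time_quot f z @ time_incr T z.1) ->
  derivable f z (1, 0) /\ 'D_(1, 0) f z = Dt T f z.
Proof.
move=> /andP[z0 zT].
have tE : time_incr T z.1 = 0^'.
  apply/seteqP; split=> P; last by apply: filterS => h Ph _.
  rewrite /time_incr /within/= => H.
  have H0 : \forall h \near (0 : R)^', 0 <= z.1 + h <= T.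
    have d0 : 0 < Num.min z.1 (T - z.1) by rewrite lt_min z0 subr_gt0.
    apply: nbhs_dnbhs; apply: filterS (nbhsx_ballx (0 : R) _ d0) => h.
    rewrite -ball_normE /= sub0r normrN lt_min !ltr_norml.
    by move=> /andP[/andP[h1 h2] /andP[h3 h4]]; apply/andP; split; lra.
  by apply: filterS2 H H0 => h + Hh; apply.
rewrite /Dt tE.
have -> : time_quot f z =
    (fun h : R => h^-1 *: ((f \o shift z) (h *: ((1, 0) : spacetime R)) - f z)).
  apply/funext => h /=; rewrite /time_quot; congr (_ *: (f _ - _)).
  apply: co_inj => m; rewrite coD coZ.
  case: (unliftP ord0 m) => [j ->|->]; rewrite ?coS ?co0 /= ?mxE; ring.
by [].
Qed.

Lemma derive_space_slice (W : normedModType R) (f : spacetime R -> W) z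
    (v : 'rV[R]_3) :
  (derivable (fun y => f (z.1, y)) z.2 v <-> derivable f z (0, v)) /\
  'D_(0, v) f z = Dx v f z.
Proof.
have E : (fun h : R => h^-1 *: (((fun y => f (z.1, y)) \o shift z.2) (h *: v)
     - f (z.1, z.2))) =
    (fun h : R => h^-1 *: ((f \o shift z) (h *: ((0, v) : spacetime R)) - f z)).
  apply/funext => h /=; rewrite -surjective_pairing; congr (_ *: (f _ - _)).
  apply: co_inj => m; rewrite coD coZ.
  case: (unliftP ord0 m) => [j ->|->]; rewrite ?coS ?co0 /= ?mxE; ring.
by rewrite /derivable /Dx /derive E.
Qed.

(** These partials are one-sided in time at the two faces of the slab, hence continuous on the
    closed slab and bounded on compact parts of it; at interior times they are the directional
    derivatives. *)
Definition Dslab (W : normedModType R) (f : spacetime R -> W) (m : 'I_4) :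
    spacetime R -> W :=
  oapp (fun j => Dx (delta_mx 0 j) f) (Dt T f) (unlift ord0 m).

Lemma C1_slab_partial (W : normedModType R) (f : spacetime R -> W) z m :
  C1_slab T f -> 0 < z.1 < T ->
  derivable f z (dir R m) /\ 'D_(dir R m) f z = Dslab f m z.
Proof.
move=> [_ dt _ dx _] zT; have sz : slab T z.
  by move/andP: zT => [? ?]; rewrite /slab/= !ltW.
rewrite /Dslab; case: (unliftP ord0 m) => [j ->|->].
  have [dE DE] := derive_space_slice f z (delta_mx 0 j).
  by rewrite dirS /= DE; split=> //; apply/dE; exact: dx.
by rewrite dir0 /=; apply: slab_derive_time => //; exact: dt.
Qed.

Lemma C1_slab_partial_continuous (W : normedModType R) (f : spacetime R -> W) m :
  C1_slab T f -> {within slab T, continuous (Dslab f m)}.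
Proof.
move=> [_ _ ct _ cx]; rewrite /Dslab.
by case: (unlift ord0 m) => [j|]; [exact: cx|exact: ct].
Qed.

Lemma C1_slab_coord (u : spacetime R -> 'rV[R]_3) z m i :
  C1_slab T u -> 0 < z.1 < T ->
  derivable (fun y => u y 0 i) z (dir R m) /\
  'D_(dir R m) (fun y => u y 0 i) z = Dslab u m z 0 i.
Proof.
move=> C1 zT; have [du <-] := C1_slab_partial m C1 zT.
split; first exact: (derivable_mxP _ _ _).1.
by rewrite derive_mx// mxE.
Qed.

Lemma C1_slab_differentiable (f : spacetime R -> R) z :
  C1_slab T f -> 0 < z.1 < T -> differentiable f z.
Proof.
move=> C1 zT; apply: differentiable_partials => m.
  by apply: filterS (near_slab zT) => y yT; exact: (C1_slab_partial m C1 yT).1.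
have cD := slab_continuous_at (C1_slab_partial_continuous C1 (m := m)) zT.
suff : 'D_(dir R m) f y @[y --> z] --> 'D_(dir R m) f z by [].
rewrite (C1_slab_partial m C1 zT).2; apply: cvg_trans cD.
apply: near_eq_cvg; apply: filterS (near_slab zT) => y yT.
by rewrite (C1_slab_partial m C1 yT).2.
Qed.

Lemma C1_slab_coord_differentiable (u : spacetime R -> 'rV[R]_3) z i :
  C1_slab T u -> 0 < z.1 < T -> differentiable (fun y => u y 0 i) z.
Proof.
move=> C1 zT; apply: differentiable_partials => m.
  by apply: filterS (near_slab zT) => y yT; exact: (C1_slab_coord m i C1 yT).1.
have cD := slab_continuous_at (C1_slab_partial_continuous C1 (m := m)) zT.
have cDi : {for z, continuous (fun y => Dslab u m y 0 i)}.
  exact: (continuous_comp cD (@coord_continuous _ _ _ _ _ _)).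
pose ui y := u y 0 i.
suff : 'D_(dir R m) ui y @[y --> z] --> 'D_(dir R m) ui z by [].
rewrite (C1_slab_coord m i C1 zT).2; apply: cvg_trans cDi.
apply: near_eq_cvg; apply: filterS (near_slab zT) => y yT.
by rewrite (C1_slab_coord m i C1 yT).2.
Qed.

(* A box for the sup norm, not a Euclidean cylinder. *)
Definition cylinder (t1 : R) (c : 'rV[R]_3) (r : R) : set (spacetime R) :=
  `[0, t1]%classic `*` [set x : 'rV[R]_3 | forall i, `[c 0 i - r, c 0 i + r]%classic (x 0 i)].

Lemma compact_cylinder t1 c r : compact (cylinder t1 c r).
Proof.
apply: compact_setX; first exact: segment_compact.
apply: (@rV_compact _ _ (fun i => `[c 0 i - r, c 0 i + r]%classic)) => i.
exact: segment_compact.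
Qed.

Lemma slab_bounded (W : normedModType R) (f : spacetime R -> W) t1 c r :
  t1 <= T -> {within slab T, continuous f} ->
  exists2 B, 0 < B & forall z, cylinder t1 c r z -> `|f z| <= B.
Proof.
move=> t1T cf.
have sub : cylinder t1 c r `<=` slab T.
  move=> z [/= + _]; rewrite in_itv/= /slab/= => /andP[-> /= H].
  exact: le_trans t1T.
have cK := continuous_compact (continuous_subspaceW sub cf) (@compact_cylinder t1 c r).
have /ex_strict_bound_gt0[B B0 H] := compact_bounded cK.
by exists B => // z Kz; apply/ltW/H; exists z.
Qed.

End C1Slab.

(** * Transport of the density *)

(* The energy balance minus K = 1 / c^2 times the velocity contracted with the
   momentum balance is a transport equation for r in which no derivative of the
   pressure p survives. The indices t, 0, 1, 2 denote partial derivatives, q is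
   |u|^2 and G is the squared Lorentz factor. *)
Lemma transport_identity (R : realType) (K r p q G : R) (u0 u1 u2 : R)
  (rt r0 r1 r2 pt p0 p1 p2 : R)
  (u0t u00 u01 u02 u1t u10 u11 u12 u2t u20 u21 u22 : R) :
  q = u0 * u0 + u1 * u1 + u2 * u2 -> G * (1 - K * q) = 1 ->
  let dq a b c := 2 * (u0 * a + u1 * b + u2 * c) in
  let W := (r + K * p) * G in
  let dG s := G * G * K * s in
  let dW r' p' s := (r' + K * p') * G + (r + K * p) * dG s in
  let qt := dq u0t u1t u2t in let q0 := dq u00 u10 u20 in
  let q1 := dq u01 u11 u21 in let q2 := dq u02 u12 u22 in
  let Wt := dW rt pt qt in let W0 := dW r0 p0 q0 in
  let W1 := dW r1 p1 q1 in let W2 := dW r2 p2 q2 in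
  (rt + K * K * (pt * q + p * qt)) * G + (r + K * K * (p * q)) * dG qt +
    ((W0 * u0 + W * u00) + (W1 * u1 + W * u11) + (W2 * u2 + W * u22)) -
  K * (u0 * ((Wt * u0 + W * u0t) +
         ((W0 * (u0 * u0) + W * (u00 * u0 + u0 * u00) + p0) +
          (W1 * (u0 * u1) + W * (u01 * u1 + u0 * u11)) +
          (W2 * (u0 * u2) + W * (u02 * u2 + u0 * u22)))) +
       u1 * ((Wt * u1 + W * u1t) +
         ((W0 * (u1 * u0) + W * (u10 * u0 + u1 * u00)) +
          (W1 * (u1 * u1) + W * (u11 * u1 + u1 * u11) + p1) +
          (W2 * (u1 * u2) + W * (u12 * u2 + u1 * u22)))) +
       u2 * ((Wt * u2 + W * u2t) +
         ((W0 * (u2 * u0) + W * (u20 * u0 + u2 * u00)) +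
          (W1 * (u2 * u1) + W * (u21 * u1 + u2 * u11)) +
          (W2 * (u2 * u2) + W * (u22 * u2 + u2 * u22) + p2)))) =
  rt + u0 * r0 + u1 * r1 + u2 * r2 +
  (r + K * p) * (u00 + u11 + u22 + G * K *
    (u0 * (u0t + u0 * u00 + u1 * u01 + u2 * u02) +
     u1 * (u1t + u0 * u10 + u1 * u11 + u2 * u12) +
     u2 * (u2t + u0 * u20 + u1 * u21 + u2 * u22))).
Proof.
move=> qE GE; rewrite /=.
have G0 : 1 - K * q != 0.
  by apply: contra_eq_neq GE => ->; rewrite mulr0 eq_sym oner_eq0.
have -> : G = (1 - K * q)^-1 by apply: (mulIf G0); rewrite GE mulVf.
rewrite qE in G0 *.
field.
exact: G0.
Qed.

Lemma sum3E (R : nmodType) (F : 'I_3 -> R) :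
  \sum_i F i = F (inord 0) + F (inord 1) + F (inord 2).
Proof.
rewrite !big_ord_recl big_ord0 addr0 addrA.
by congr (F _ + F _ + F _); apply: val_inj; rewrite /= inordK.
Qed.

(** The scalar identity in indexed form: [U i j] stands for the derivative of [u i] in direction
    [j], and the right-hand side isolates the enthalpy factor [r + K * p] to be bounded later. *)
Lemma transport_from_balance (R : realType) (K r p q G rt pt : R)
    (u ut r' p' : 'I_3 -> R) (U : 'I_3 -> 'I_3 -> R) :
  q = \sum_i u i * u i -> G * (1 - K * q) = 1 ->
  let qt := 2 * (\sum_i u i * ut i) in
  let qx j := 2 * (\sum_i u i * U i j) in
  let W := (r + K * p) * G in
  let dG s := G * G * K * s in
  let dW r' p' s := (r' + K * p') * G + (r + K * p) * dG s in
  (rt + K * K * (pt * q + p * qt)) * G + (r + K * K * (p * q)) * dG qt +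
    \sum_j (dW (r' j) (p' j) (qx j) * u j + W * U j j) = 0 ->
  (forall i, dW rt pt qt * u i + W * ut i +
    \sum_j (dW (r' j) (p' j) (qx j) * (u i * u j) +
      W * (U i j * u j + u i * U j j) + p' j * (i == j)%:R) = 0) ->
  rt + \sum_j u j * r' j = - ((r + K * p) * (\sum_j U j j +
    G * K * \sum_i u i * (ut i + \sum_j u j * U i j))).
Proof.
move=> qE GE; cbv zeta; rewrite !sum3E => E0 Ei.
have := (Ei (inord 0), Ei (inord 1), Ei (inord 2)).
rewrite !sum3E -!val_eqE /= !inordK//= {Ei}.
rewrite !sum3E in qE.
move: qE E0.
move: (u (inord 0)) (u (inord 1)) (u (inord 2)) => u0 u1 u2.
move: (ut (inord 0)) (ut (inord 1)) (ut (inord 2)) => ut0 ut1 ut2.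
move: (r' (inord 0)) (r' (inord 1)) (r' (inord 2)) => r0 r1 r2.
move: (p' (inord 0)) (p' (inord 1)) (p' (inord 2)) => p0 p1 p2.
move: (U (inord 0) (inord 0)) (U (inord 0) (inord 1)) (U (inord 0) (inord 2))
  => u00 u01 u02.
move: (U (inord 1) (inord 0)) (U (inord 1) (inord 1)) (U (inord 1) (inord 2))
  => u10 u11 u12.
move: (U (inord 2) (inord 0)) (U (inord 2) (inord 1)) (U (inord 2) (inord 2))
  => u20 u21 u22.
move=> qE E0 [[E1 E2] E3].
have := transport_identity r p rt r0 r1 r2 pt p0 p1 p2 ut0 u00 u01 u02
  ut1 u10 u11 u12 ut2 u20 u21 u22 qE GE.
cbv zeta => TI.
apply/eqP; rewrite -subr_eq0 opprK; apply/eqP.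
apply: etrans (etrans (esym TI) _); first by ring.
(* The zeros mark the places of the energy balance and of the three momentum balances in the
   combination, and are replaced by them next. *)
transitivity (0 - K * (u0 * 0 + u1 * 0 + u2 * 0) : R); last by ring.
rewrite -{1}E0 -{1}E1 -{1}E2 -{1}E3.
ring.
Qed.

(** * Derivatives of the conserved quantities and fluxes in terms of density, pressure and
    velocity *)

Section FluidDerivatives.
Variables (R : realType) (X : normedModType R) (K : R).
Variables (r p : X -> R) (ui : 'I_3 -> X -> R) (x : X).
Hypotheses (dr : differentiable r x) (dp : differentiable p x)
  (du : forall i, differentiable (ui i) x).

Definition speed2 : X -> R := \sum_i ui i * ui i.
Definition gamma2 : X -> R := fun y => (1 - K * speed2 y)^-1.
Definition enthalpy : X -> R := fun y => (r y + K * p y) * gamma2 y.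
(** With [K = 1 / c^2], the factor [K * K] is the [1 / c^4] of the energy. *)
Definition energy_density : X -> R :=
  fun y => (r y + K * K * (p y * speed2 y)) * gamma2 y.
Definition flux i j : X -> R :=
  fun y => enthalpy y * (ui i y * ui j y) + p y * (i == j)%:R.

Hypothesis q1 : 1 - K * speed2 x != 0.

Lemma differentiable_speed2 : differentiable speed2 x.
Proof. by apply: differentiable_sum => i; exact: differentiableM. Qed.

Let dKs : differentiable (fun y => 1 - K * speed2 y) x.
Proof.
apply: differentiableB; first exact: differentiable_cst.
apply: differentiableM; first exact: differentiable_cst.
exact: differentiable_speed2.
Qed.

Lemma differentiable_gamma2 : differentiable gamma2 x.
Proof. exact: differentiableV. Qed.

Let dKp : differentiable (fun y => K * p y) x.
Proof. by apply: differentiableM => //; exact: differentiable_cst. Qed.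

Lemma differentiable_enthalpy : differentiable enthalpy x.
Proof.
apply: differentiableM; last exact: differentiable_gamma2.
exact: differentiableD.
Qed.

Lemma differentiable_energy_density : differentiable energy_density x.
Proof.
apply: differentiableM; last exact: differentiable_gamma2.
apply: differentiableD => //.
apply: differentiableM; first exact: differentiable_cst.
apply: differentiableM => //; exact: differentiable_speed2.
Qed.

Lemma differentiable_enthalpyM i : differentiable (fun y => enthalpy y * ui i y) x.
Proof. by apply: differentiableM => //; exact: differentiable_enthalpy. Qed.

Lemma differentiable_flux i j : differentiable (flux i j) x.
Proof.
apply: differentiableD.
  apply: differentiableM; first exact: differentiable_enthalpy.
  exact: differentiableM.
by apply: differentiableM => //; exact: differentiable_cst.
Qed.

Variable v : X.
Let r' := 'D_v r x.
Let p' := 'D_v p x.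
Let u' i := 'D_v (ui i) x.
Let q' := 2 * (\sum_i ui i x * u' i).
Let G := gamma2 x.
Let W := enthalpy x.
Let dG := G * G * K * q'.
Let dW := (r' + K * p') * G + (r x + K * p x) * dG.

Let Dr : is_derive x v r r'. Proof. exact/derivableP/diff_derivable. Qed.
Let Dp : is_derive x v p p'. Proof. exact/derivableP/diff_derivable. Qed.
Let Du i : is_derive x v (ui i) (u' i). Proof. exact/derivableP/diff_derivable. Qed.

Let Dq : is_derive x v speed2 q'.
Proof.
apply: (is_derive_eq (is_derive_sum (fun i => is_deriveM (Du i) (Du i)))).
by rewrite /q' mulr_sumr; apply: eq_bigr => i _; rewrite /GRing.scale/=; ring.
Qed.

Let DG : is_derive x v gamma2 dG.
Proof.
have D1 := is_deriveB (is_derive_cst (1 : R) x v) (is_deriveZ K Dq).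
apply: DeriveDef; first exact/diff_derivable/differentiable_gamma2.
have DV : derivable (fun y => 1 - K * speed2 y) x v by exact: diff_derivable.
have := @deriveV _ _ (fun y => 1 - K * speed2 y) x v q1 DV => E.
rewrite [LHS]E {E}.
have -> : 'D_v (fun y => 1 - K * speed2 y) x = 0 - K *: q' by case: D1.
by rewrite /dG /G /gamma2 /GRing.scale/= expr2 invfM; ring.
Qed.

Let DW : is_derive x v enthalpy dW.
Proof.
apply: (is_derive_eq (is_deriveM (is_deriveD Dr (is_deriveZ K Dp)) DG)).
rewrite /dW -[(_ + _) x]/(r x + K * p x) /GRing.scale/= -/G; ring.
Qed.

Lemma derive_energy_density : 'D_v energy_density x =
  (r' + K * K * (p' * speed2 x + p x * q')) * G + (r x + K * K * (p x * speed2 x)) * dG.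
Proof.
have [_ ->] := is_deriveM (is_deriveD Dr (is_deriveZ (K * K) (is_deriveM Dp Dq))) DG.
rewrite -[(_ + _) x]/(r x + K * K * (p x * speed2 x)) /GRing.scale/= -/G; ring.
Qed.

Lemma derive_enthalpyM i : 'D_v (fun y => enthalpy y * ui i y) x = dW * ui i x + W * u' i.
Proof. by have [_ ->] := is_deriveM DW (Du i); rewrite /GRing.scale/= -/W; ring. Qed.

Lemma derive_flux i j : 'D_v (flux i j) x =
  dW * (ui i x * ui j x) + W * (u' i * ui j x + ui i x * u' j) + p' * (i == j)%:R.
Proof.
have [_ ->] := is_deriveD (is_deriveM DW (is_deriveM (Du i) (Du j)))
  (is_deriveM Dp (is_derive_cst ((i == j)%:R : R) x v)).
by rewrite -[(_ * _) x]/(ui i x * ui j x) /GRing.scale/= -/W; ring.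
Qed.

End FluidDerivatives.

Lemma enorm_sqr (R : realType) (v : 'rV[R]_3) : enorm v ^+ 2 = dotp v v.
Proof.
by rewrite sqr_sqrtr// sumr_ge0// => i _; rewrite -expr2 sqr_ge0.
Qed.

Lemma derive_time_space (R : realType) (f : spacetime R -> R) z (w : 'rV[R]_3) :
  differentiable f z -> 'D_(1, w) f z =
    'D_(dir R ord0) f z + \sum_j w 0 j * 'D_(dir R (lift ord0 j)) f z.
Proof.
move=> df; rewrite derive_co_sum// big_ord_recl co0 mul1r; congr (_ + _).
by apply: eq_bigr => j _; rewrite coS.
Qed.

Section DensityTransport.
Variables (R : realType) (k gam c T : R) (rho : spacetime R -> R)
  (u : spacetime R -> 'rV[R]_3).
Hypotheses (c0 : 0 < c) (C1rho : C1_slab T rho) (C1u : C1_slab T u)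
  (uc : forall z, slab T z -> enorm (u z) < c).

Let K := (c ^+ 2)^-1.
Let p z := pressure k gam (rho z).
Let ui (i : 'I_3) z := u z 0 i.

Lemma speed2E z : speed2 ui z = enorm (u z) ^+ 2.
Proof. by rewrite enorm_sqr /speed2 fct_sumE. Qed.

Lemma lorentz_gt0 z : slab T z -> 0 < 1 - K * speed2 ui z.
Proof.
move=> /uc uz; rewrite speed2E subr_gt0 mulrC ltr_pdivrMr ?exprn_gt0// mul1r.
by rewrite ltrXn2r// ?nnegrE ?sqrtr_ge0// ltW.
Qed.

Lemma differentiable_pressure z : 0 < z.1 < T -> 0 < rho z -> differentiable p z.
Proof.
move=> zT rz; apply: (@differentiable_comp _ _ _ _ rho (pressure k gam)).
  exact: C1_slab_differentiable C1rho zT.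
apply/derivable1_diffP; apply: derivableM; first exact: derivable_cst.
by apply: derivable_powR; rewrite in_itv/= rz.
Qed.

(** Positivity of [rho] persists near [z], so all fluxes are differentiable on a neighbourhood and
    the four weak equations hold at [z]; their combination then leaves the derivative of [rho] along
    [(1, u)]. *)
Lemma density_transport z : euler_equations k gam c T rho u ->
  0 < z.1 < T -> 0 < rho z ->
  'D_(1, u z) rho z = - ((rho z + K * p z) *
    (\sum_j 'D_(dir R (lift ord0 j)) (ui j) z +
     gamma2 K ui z * K * \sum_i ui i z * 'D_(1, u z) (ui i) z)).
Proof.
move=> [eqE eqM] zT rz.
have near_z : \forall y \near z, 0 < y.1 < T /\ 0 < rho y.
  apply: filterI; first exact: near_slab.
  have cr := differentiable_continuous (C1_slab_differentiable C1rho zT).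
  exact: (cvgr_gt _ cr).
have dA y : 0 < y.1 < T /\ 0 < rho y -> [/\ differentiable rho y,
    differentiable p y, forall i, differentiable (ui i) y &
    1 - K * speed2 ui y != 0].
  move=> [yT ry]; split.
  - exact: C1_slab_differentiable C1rho yT.
  - exact: differentiable_pressure.
  - by move=> i; exact: C1_slab_coord_differentiable C1u yT.
  - by rewrite gt_eqF// lorentz_gt0//; case/andP: yT => *; rewrite /slab/= !ltW.
have nearC (f : spacetime R -> R) :
    (forall y, 0 < y.1 < T /\ 0 < rho y -> differentiable f y) ->
    \forall y \near z, {for y, continuous f}.
  by move=> df; apply: filterS near_z => y /df; exact: differentiable_continuous.
have [drz dpz duz qz] := dA z (conj zT rz).
have energyE : (fun y => energy k gam c (rho y) (u y)) = energy_density K rho p ui.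
  apply/funext => y; rewrite /energy /energy_density /gamma2 speed2E /lorentz_denom /K.
  congr ((_ + _) * (1 - _)^-1); last by rewrite mulrC.
  by rewrite mulrC -invfM -exprD.
have momentumE j : (fun y => momentum k gam c (rho y) (u y) 0 j) =
    (fun y => enthalpy K rho p ui y * ui j y).
  apply/funext => y; rewrite /momentum mxE /enthalpy /gamma2 speed2E /lorentz_denom /K.
  by congr ((_ + _) * (1 - _)^-1 * _); rewrite mulrC.
have fluxE i j : (fun y => row i (momentum_flux k gam c (rho y) (u y)) 0 j) =
    flux K rho p ui i j.
  apply/funext => y; rewrite /flux -[enthalpy _ _ _ _ _]/(enthalpy K rho p ui y).
  rewrite !mxE big_ord1 !mxE /enthalpy /gamma2 speed2E /lorentz_denom /K.
  by rewrite (mulrC _ (p y)) (mulrC _ (enorm _ ^+ 2)) mulr_natr.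
have E0 : 'D_(dir R ord0) (energy_density K rho p ui) z +
    \sum_j 'D_(dir R (lift ord0 j)) (fun y => enthalpy K rho p ui y * ui j y) z = 0.
  have -> : \sum_j 'D_(dir R (lift ord0 j)) (fun y => enthalpy K rho p ui y * ui j y) z =
      \sum_j 'D_(0, delta_mx 0 j) (fun y => momentum k gam c (rho y) (u y) 0 j) z.
    by apply: eq_bigr => j _; rewrite momentumE dirS.
  rewrite dir0 -energyE; apply: (conservation_law_pointwise eqE zT).
  - by apply: nearC => y /dA[? ? ? ?]; rewrite energyE; exact: differentiable_energy_density.
  - by rewrite energyE; exact: differentiable_energy_density.
  - move=> j; rewrite momentumE; apply: nearC => y /dA[? ? ? ?].
    exact: differentiable_enthalpyM.
  - by move=> j; rewrite momentumE; exact: differentiable_enthalpyM.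
have Ei i : 'D_(dir R ord0) (fun y => enthalpy K rho p ui y * ui i y) z +
    \sum_j 'D_(dir R (lift ord0 j)) (flux K rho p ui i j) z = 0.
  have -> : \sum_j 'D_(dir R (lift ord0 j)) (flux K rho p ui i j) z =
      \sum_j 'D_(0, delta_mx 0 j)
        (fun y => row i (momentum_flux k gam c (rho y) (u y)) 0 j) z.
    by apply: eq_bigr => j _; rewrite fluxE dirS.
  rewrite dir0 -momentumE; apply: (conservation_law_pointwise (eqM i) zT).
  - by apply: nearC => y /dA[? ? ? ?]; rewrite momentumE; exact: differentiable_enthalpyM.
  - by rewrite momentumE; exact: differentiable_enthalpyM.
  - by move=> j; rewrite fluxE; apply: nearC => y /dA[? ? ? ?]; exact: differentiable_flux.
  - by move=> j; rewrite fluxE; exact: differentiable_flux.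
have qE : speed2 ui z = \sum_i ui i z * ui i z by rewrite /speed2 fct_sumE.
have GE : gamma2 K ui z * (1 - K * speed2 ui z) = 1 by rewrite mulVf.
move: E0; under eq_bigr do rewrite derive_enthalpyM//.
rewrite derive_energy_density// => E0.
rewrite derive_time_space//.
under [X in _ = - (_ * (_ + _ * X))]eq_bigr do rewrite derive_time_space//.
apply: (transport_from_balance qE GE E0) => i.
have := Ei i; under eq_bigr do rewrite derive_flux//.
by rewrite derive_enthalpyM.
Qed.

End DensityTransport.

Lemma normr_row_le (R : realType) (v : 'rV[R]_3) i : `|v 0 i| <= `|v|.
Proof.
rewrite [X in _ <= X]/Num.norm/= mx_normrE.
by apply/bigmax_geP; right; exists (0, i).
Qed.

Lemma coord_le_enorm (R : realType) (v : 'rV[R]_3) i : `|v 0 i| <= enorm v.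
Proof.
rewrite -(ler_pXn2r (n := 2))// ?nnegrE ?sqrtr_ge0// real_normK ?num_real//.
rewrite enorm_sqr /dotp (bigD1 i)//= -expr2 lerDl sumr_ge0// => j _.
by rewrite -expr2 sqr_ge0.
Qed.

Lemma continuous_within_comp (X Y Z : topologicalType)
    (A : set X) (B : set Y) (g : X -> Y) (f : Y -> Z) :
  continuous g -> (forall x, A x -> B (g x)) ->
  {within B, continuous f} -> {within A, continuous (f \o g)}.
Proof.
move=> cg gAB cf; apply/subspace_continuousP => x Ax P nP.
have /subspace_continuousP/(_ _ (gAB _ Ax) _ nP) := cf.
move=> H; have {}H : nbhs (g x) (fun y => B y -> P (f y)) by exact: H.
suff : nbhs x (fun y => A y -> P (f (g y))) by [].
have Hg : nbhs x (fun y => B (g y) -> P (f (g y))) by exact: (cg x _ H).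
by move: Hg; apply: filterS => y Hy Ay; apply: Hy; exact: gAB.
Qed.

Lemma Dslab_bounded (R : realType) (T t1 : R) (u : spacetime R -> 'rV[R]_3)
    (x : 'rV[R]_3) (r : R) : t1 <= T -> C1_slab T u ->
  exists2 B, 0 < B & forall z, cylinder t1 x r z ->
    forall m i, `|Dslab T u m z 0 i| <= B.
Proof.
move=> t1T C1.
have /choice[B BP] : forall m, exists B, 0 < B /\
    forall z, cylinder t1 x r z -> `|Dslab T u m z| <= B.
  move=> m; have [B B0 BP] := slab_bounded x r t1T (C1_slab_partial_continuous C1 (m := m)).
  by exists B.
exists (\sum_m B m).
  by rewrite (bigD1 ord0)//= ltr_wpDr ?(BP _).1// sumr_ge0// => m _; exact/ltW/(BP m).1.
move=> z Kz m i; apply: le_trans (normr_row_le _ _) _.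
apply: le_trans ((BP m).2 z Kz) _.
by rewrite (bigD1 m)//= lerDl sumr_ge0// => n _; exact/ltW/(BP n).1.
Qed.

(** A negative derivative would make the difference quotients at small negative [h] negative,
    whereas there both [h] and [g h - g 0] are nonpositive. *)
Lemma derive_ge0_left_max (R : realType) (g : R -> R) (D sigma : R) :
  0 < sigma -> is_derive (0 : R) (1 : R) g D ->
  (forall s, - sigma < s -> s < 0 -> g s <= g 0) -> 0 <= D.
Proof.
move=> s0 [dg DE] gle; rewrite leNgt; apply/negP => D0.
have dl : h^-1 *: ((g \o shift 0) (h *: (1 : R)) - g 0) @[h --> 0^'] --> D.
  by rewrite -DE; exact: dg.
have N : \forall h \near (0 : R), h != 0 ->
    h^-1 *: ((g \o shift 0) (h *: (1 : R)) - g 0) < 0 by exact: (cvgr_lt _ dl).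
have [e e0 He] := near_norm_ball N.
pose h := - (Num.min e sigma / 2).
have m0 : 0 < Num.min e sigma by rewrite lt_min e0.
have h0 : h < 0 by rewrite oppr_lt0 divr_gt0.
have hs : - sigma < h.
  rewrite ltrN2; apply: (@lt_le_trans _ _ (Num.min e sigma)); last by rewrite ge_min lexx orbT.
  by rewrite ltr_pdivrMr// ltr_pMr// ltr1n.
have he : `|h - 0| < e.
  rewrite subr0 normrN gtr0_norm ?divr_gt0//.
  apply: (@lt_le_trans _ _ (Num.min e sigma)); last by rewrite ge_min lexx.
  by rewrite ltr_pdivrMr// ltr_pMr// ltr1n.
have := He h he; rewrite lt_eqF//.
rewrite /= addr0 (_ : h%:A = h); last exact: mulr1.
rewrite /GRing.scale/= => /(_ isT) H.
have := gle h hs h0; rewrite -subr_le0 => G.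
suff : 0 <= h^-1 * (g h - g 0) by lra.
by rewrite nmulr_rge0// invr_lt0.
Qed.

(** * The shrinking tube around a straight line *)

Section CoordDerive.
Variable R : realType.
Implicit Types (z w : spacetime R).

Lemma differentiable_time z : differentiable (fun y : spacetime R => y.1) z.
Proof.
have := differentiable_co ord0 z.
by have -> : (fun y => co y ord0) = (fun y : spacetime R => y.1)
  by apply/funext => y; rewrite co0.
Qed.

Lemma derive_time z w : 'D_w (fun y : spacetime R => y.1) z = w.1.
Proof.
have := derive_co ord0 w z; rewrite co0.
by have -> : (fun y => co y ord0) = (fun y : spacetime R => y.1)
  by apply/funext => y; rewrite co0.
Qed.

Lemma differentiable_space i z : differentiable (fun y : spacetime R => y.2 0 i) z.
Proof.
have := differentiable_co (lift ord0 i) z.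
by have -> : (fun y => co y (lift ord0 i)) = (fun y : spacetime R => y.2 0 i)
  by apply/funext => y; rewrite coS.
Qed.

Lemma derive_space i z w : 'D_w (fun y : spacetime R => y.2 0 i) z = w.2 0 i.
Proof.
have := derive_co (lift ord0 i) w z; rewrite coS.
by have -> : (fun y => co y (lift ord0 i)) = (fun y : spacetime R => y.2 0 i)
  by apply/funext => y; rewrite coS.
Qed.

Lemma is_derive_time z w : is_derive z w (fun y : spacetime R => y.1) w.1.
Proof. by rewrite -(derive_time z w); exact/derivableP/diff_derivable/differentiable_time. Qed.

Lemma is_derive_space i z w : is_derive z w (fun y : spacetime R => y.2 0 i) (w.2 0 i).
Proof. by rewrite -(derive_space i z w); exact/derivableP/diff_derivable/differentiable_space. Qed.

Variables (x a : 'rV[R]_3) (l d : R).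

Definition shrink : spacetime R -> R := fun y => d * expR (- l * y.1).

Definition offset (i : 'I_3) : spacetime R -> R :=
  fun y => y.2 0 i - x 0 i - y.1 * a 0 i.

(** Squared radius minus squared Euclidean distance to the line: positive exactly inside the tube
    and, unlike the distance itself, differentiable on the axis. *)
Definition tube_fun : spacetime R -> R :=
  fun y => shrink y * shrink y - \sum_i offset i y * offset i y.

Lemma differentiable_expRt (m : R) z :
  differentiable (fun y : spacetime R => expR (- m * y.1)) z.
Proof.
apply: (@differentiable_comp _ _ _ _ (fun y : spacetime R => - m * y.1) expR).
  apply: differentiableM; first exact: differentiable_cst.
  exact: differentiable_time.
by apply/derivable1_diffP; case: (is_derive_expR (- m * z.1)).
Qed.

Lemma is_derive_expRt (m : R) z w :
  is_derive z w (fun y : spacetime R => expR (- m * y.1)) (- m * w.1 * expR (- m * z.1)).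
Proof.
have df : differentiable (fun y : spacetime R => - m * y.1) z.
  apply: differentiableM; first exact: differentiable_cst.
  exact: differentiable_time.
apply: (is_derive_eq (derive_comp_scalar w (is_derive_expR (- m * z.1)) df)).
by have [_ ->] := is_deriveZ (- m) (is_derive_time z w); rewrite mulrC.
Qed.

Lemma differentiable_shrink z : differentiable shrink z.
Proof.
apply: differentiableM; first exact: differentiable_cst.
exact: differentiable_expRt.
Qed.

Lemma differentiable_offset i z : differentiable (offset i) z.
Proof.
apply: differentiableB.
  apply: differentiableB; [exact: differentiable_space|exact: differentiable_cst].
apply: differentiableM; [exact: differentiable_time|exact: differentiable_cst].
Qed.

Lemma differentiable_tube_fun z : differentiable tube_fun z.
Proof.
apply: differentiableB.
  by apply: differentiableM; exact: differentiable_shrink.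
have -> : (fun y => \sum_i offset i y * offset i y) = \sum_i offset i * offset i.
  by apply/funext => y; rewrite fct_sumE.
by apply: differentiable_sum => i; apply: differentiableM; exact: differentiable_offset.
Qed.

Lemma derive_tube_fun z (w : 'rV[R]_3) : 'D_(1, w) tube_fun z =
  - 2 * l * (shrink z * shrink z) - 2 * \sum_i offset i z * (w 0 i - a 0 i).
Proof.
pose v : spacetime R := (1, w).
have ds : is_derive z v shrink (- l * shrink z).
  apply: (is_derive_eq (is_deriveZ d (is_derive_expRt l z v))).
  by rewrite /shrink /GRing.scale/=; ring.
have do_ i : is_derive z v (offset i) (w 0 i - a 0 i).
  have d1 := is_deriveB (is_derive_space i z v) (is_derive_cst (x 0 i) z v).
  have d2 := is_deriveM (is_derive_time z v) (is_derive_cst (a 0 i) z v).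
  apply: (is_derive_eq (is_deriveB d1 d2)).
  by rewrite /GRing.scale/= mulr0 add0r mulr1 subr0.
have dS := is_derive_sum (fun i => is_deriveM (do_ i) (do_ i)).
have E : tube_fun = shrink * shrink - \sum_i offset i * offset i.
  by apply/funext => y; rewrite /tube_fun -[RHS]/(_ - (\sum_i _) y) fct_sumE.
rewrite E; have [_ ->] := is_deriveB (is_deriveM ds ds) dS.
rewrite mulr_sumr /GRing.scale/=; congr (_ - _); first by ring.
by apply: eq_bigr => i _; ring.
Qed.

End CoordDerive.

(** * Vacuum around a straight characteristic *)

Section Tube.
Variables (R : realType) (k gam c T : R) (rho0 : 'rV[R]_3 -> R)
  (u0 : 'rV[R]_3 -> 'rV[R]_3) (rho : spacetime R -> R)
  (u : spacetime R -> 'rV[R]_3).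
Hypotheses (gam1 : 1 <= gam) (c0 : 0 < c)
  (reg : regular_solution k gam c rho0 u0 T rho u).

Let K := (c ^+ 2)^-1.
Let ui (i : 'I_3) z := u z 0 i.

Let rho_ge0 z : slab T z -> 0 <= rho z.
Proof. by case: reg => _ _ [+ _ _] _ _; exact. Qed.

Let C1rho : C1_slab T rho. Proof. by case: reg => _ _ []. Qed.
Let C1u : C1_slab T u. Proof. by case: reg => _ _ []. Qed.

Let uc z : slab T z -> enorm (u z) < c.
Proof. by case: reg => _ _ _ H _ /H[]. Qed.

Lemma velocity_coord_le z i : slab T z -> `|u z 0 i| <= c.
Proof. by move=> /uc uz; apply: le_trans (coord_le_enorm _ _) (ltW uz). Qed.

(* This is where the subluminal sound speed is used. *)
Lemma pressure_le z : slab T z -> K * pressure k gam (rho z) <= rho z.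
Proof.
move=> sz; have r0 := rho_ge0 sz.
have : Num.sqrt (dpressure k gam (rho z)) < c by case: reg => _ _ _ /(_ _ sz)[].
have d0 : 0 <= dpressure k gam (rho z).
  have gam0 : 0 <= gam by apply: le_trans gam1.
  by apply: mulr_ge0; [apply: mulr_ge0 => //; exact: sqr_ge0|exact: powR_ge0].
rewrite -(ltr_pXn2r (n := 2))// ?nnegrE ?sqrtr_ge0 ?(ltW c0)// sqr_sqrtr// => dc.
rewrite /K mulrC ler_pdivrMr ?exprn_gt0// /pressure -(mulr_powRB1 r0); last first.
  exact: lt_le_trans gam1.
rewrite mulrCA ler_wpM2l//; apply: le_trans (ltW dc).
by rewrite /dpressure ler_wpM2r ?powR_ge0// ler_peMr ?sqr_ge0.
Qed.

Lemma pressure_ge0 z : 0 <= pressure k gam (rho z).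
Proof. by rewrite mulr_ge0 ?sqr_ge0 ?powR_ge0. Qed.

Lemma within_ui i : {within slab T, continuous (ui i)}.
Proof.
case: C1u => cu _ _ _ _ z.
exact: (continuous_comp (cu z) (@coord_continuous _ _ _ _ _ _)).
Qed.

Lemma within_gamma2 : {within slab T, continuous (gamma2 K ui)}.
Proof.
have cs : {within slab T, continuous (speed2 ui)}.
  have -> : speed2 ui = (fun z => ui ord0 z * ui ord0 z +
    (ui (inord 1) z * ui (inord 1) z + ui (inord 2) z * ui (inord 2) z)).
    apply/funext => z; rewrite /speed2 fct_sumE sum3E addrA.
    by congr (ui _ z * ui _ z + _ + _); apply: val_inj; rewrite /= inordK.
  by move=> z; do ?apply: cvgD; apply: cvgM; exact: within_ui.
rewrite continuous_subspace_in => z; rewrite inE => sz.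
apply: cvgV; first by rewrite gt_eqF// (lorentz_gt0 c0 uc sz).
apply: cvgB; first exact: cvg_cst.
apply: cvgM; [exact: cvg_cst|exact: cs].
Qed.

Variables (t1 : R) (x : 'rV[R]_3).
Hypotheses (t1_gt0 : 0 < t1) (t1T : t1 < T).
Local Notation a := (u0 x).
(** The line moves each coordinate by at most [t1 * c]; one unit is for the tube, whose radius is at
    most 1, and one for the backward segment that leaves the maximum point. *)
Let r := 2 + t1 * c.
Local Notation C := (cylinder t1 x r).

Lemma cylinder_slab z : C z -> slab T z.
Proof.
move=> [/= + _]; rewrite in_itv/= /slab/= => /andP[-> /= H].
exact: le_trans (ltW t1T).
Qed.

(** The derivatives of [u] and the Lorentz factor are bounded on the box, and [pressure_le] bounds
    [rho + K * p] by [2 * rho]; hence a bound linear in [rho] for every admissible exponent. *)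
Lemma transport_growth : exists2 L, 0 < L & forall z, C z -> 0 < z.1 -> 0 < rho z ->
  'D_(1, u z) rho z <= L * rho z.
Proof.
have [B B0 BP] := Dslab_bounded x r (ltW t1T) C1u.
have [G G0 GP] := slab_bounded x r (ltW t1T) within_gamma2.
(* [3 * B] bounds the divergence of [u], and [B + 3 * (c * B)] each component of the acceleration,
   which is then contracted with a velocity whose components are at most [c]. *)
pose M := 3 * B + G * K * (3 * (c * (B + 3 * (c * B)))).
have K0 : 0 < K by rewrite invr_gt0 exprn_gt0.
have M0 : 0 < M.
  by rewrite addr_gt0// ?mulr_gt0// addr_gt0// !mulr_gt0.
exists (2 * M); first by rewrite mulr_gt0.
move=> z Cz z0 rz; have sz := cylinder_slab Cz.
have zT : 0 < z.1 < T.
  rewrite z0; case: Cz => /= + _; rewrite in_itv/= => /andP[_ H].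
  exact: le_lt_trans t1T.
have euler : euler_equations k gam c T rho u by case: reg.
rewrite (density_transport c0 C1rho C1u uc euler zT rz).
have DB m i : `|'D_(dir R m) (ui i) z| <= B.
  by rewrite (C1_slab_coord m i C1u zT).2; exact: BP.
have ub i : `|ui i z| <= c by exact: velocity_coord_le.
set A := (X in - (_ * X)).
have AM : `|A| <= M.
  have sum3 (F : 'I_3 -> R) b : (forall i, `|F i| <= b) -> `|\sum_i F i| <= 3 * b.
    move=> Fb; rewrite sum3E.
    have := ler_normD (F (inord 0) + F (inord 1)) (F (inord 2)).
    have := ler_normD (F (inord 0)) (F (inord 1)).
    have := Fb (inord 0); have := Fb (inord 1); have := Fb (inord 2); lra.
  apply: le_trans (ler_normD _ _) _; apply: lerD.
    by apply: (sum3) => i; exact: DB.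
  rewrite normrM; apply: ler_pM => //.
    by rewrite normrM (gtr0_norm K0) ler_wpM2r ?(ltW K0)//; exact: GP.
  apply: (sum3) => i; rewrite normrM; apply: ler_pM => //; first exact: ub.
  rewrite (derive_time_space (u z) (C1_slab_coord_differentiable i C1u zT)).
  apply: le_trans (ler_normD _ _) _; apply: lerD; first exact: DB.
  by apply: (sum3) => j; rewrite normrM; apply: ler_pM => //; [exact: ub|exact: DB].
have pr := pressure_le sz; have p0 := pressure_ge0 z.
have h0 : 0 <= rho z + K * pressure k gam (rho z).
  exact: addr_ge0 (ltW rz) (mulr_ge0 (ltW K0) p0).
have h2 : rho z + K * pressure k gam (rho z) <= 2 * rho z by lra.
rewrite -mulrN; apply: (@le_trans _ _ ((rho z + K * pressure k gam (rho z)) * M)).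
  by rewrite ler_wpM2l// (le_trans _ AM)// -normrN ler_norm.
rewrite [leRHS]mulrAC; apply: ler_wpM2r => //; exact: ltW.
Qed.

Lemma initial_bound i : `|a 0 i| <= c.
Proof.
have s0 : slab T ((0, x) : spacetime R).
  by rewrite /slab/= lexx ltW// (lt_trans t1_gt0).
have [_ uE] : rho (0, x) = rho0 x /\ u (0, x) = u0 x.
  by case: reg => _ + _ _ _; exact.
by have := velocity_coord_le i s0; rewrite uE.
Qed.

Lemma offset_cylinder (t : R) (y : 'rV[R]_3) : 0 <= t -> t <= t1 ->
  (forall i, `|y 0 i - x 0 i - t * a 0 i| <= 2) -> C (t, y).
Proof.
move=> t0 tt1 H; split=> [|i] /=; rewrite in_itv/=; first by rewrite t0.
rewrite -ler_distl; have := H i; have := initial_bound i => ai Hi.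
have -> : y 0 i - x 0 i = (y 0 i - x 0 i - t * a 0 i) + t * a 0 i by ring.
apply: le_trans (ler_normD _ _) _; apply: lerD => //.
by rewrite normrM (ger0_norm t0) ler_pM.
Qed.

Variable B : R.
Hypotheses (B0 : 0 < B)
  (BP : forall z, C z -> forall m i, `|Dslab T u m z 0 i| <= B).

(** The mean value theorem at fixed time. [MVT_line] locates its point only by absolute value, so
    the segment has to stay in the box for negative [s] as well. *)
Lemma cylinder_lipschitz (t : R) (y y' : 'rV[R]_3) i : 0 < t -> t <= t1 ->
  (forall s, `|s| <= 1 -> C (t, y + s *: (y' - y))) ->
  `|u (t, y') 0 i - u (t, y) 0 i| <= B * \sum_j `|y' 0 j - y 0 j|.
Proof.
move=> t0 tt1 Cs; pose v : spacetime R := (0, y' - y).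
have lE s : (t, y) + s *: v = (t, y + s *: (y' - y)).
  by congr pair; rewrite /= scaler0 addr0.
have tT : 0 < t < T by rewrite t0 (le_lt_trans tt1).
have df s : differentiable (ui i) ((t, y) + s *: v).
  by rewrite lE; apply: C1_slab_coord_differentiable C1u _.
have [|s s1 E] := @MVT_line _ _ (ui i) (t, y) v 1.
  by move=> s _; exact: diff_derivable.
rewrite normr1 in s1.
have -> : u (t, y') 0 i - u (t, y) 0 i = ui i ((t, y) + 1 *: v) - ui i (t, y).
  by rewrite lE scale1r [y + _]addrC subrK.
rewrite E mul1r derive_co_sum// big_ord_recl co0 mul0r add0r.
apply: le_trans (ler_norm_sum _ _ _) _; rewrite mulr_sumr; apply: ler_sum => j _.
rewrite coS normrM mulrC !mxE; apply: ler_pM => //.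
rewrite lE (C1_slab_coord _ i C1u _).2//; apply: BP; exact: Cs.
Qed.

Variables (L delta : R).
Hypotheses (LP : forall z, C z -> 0 < z.1 -> 0 < rho z ->
    'D_(1, u z) rho z <= L * rho z)
  (d0 : 0 < delta) (d1 : delta <= 1)
  (vac : forall y : 'rV[R]_3, (forall i, `|y 0 i - x 0 i| < delta) -> rho0 y = 0).

(** Inside the tube of radius [s], each component of [u - a] is at most [(3 * B + 1) * s] and each
    offset at most [s]; three such products give [(9 * B + 3) * s^2], exactly what the shrinking of
    the radius compensates. *)
Let l := 9 * B + 3.
Let off := offset x a.
Let shr := shrink l delta.
Let psi := tube_fun x a l delta.

Lemma shrink_gt0 z : 0 < shr z.
Proof. by rewrite mulr_gt0// expR_gt0. Qed.

Lemma shrink_le1 z : 0 <= z.1 -> shr z <= delta.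
Proof.
move=> z0; rewrite /shr /shrink ger_pMr// -expR0 ler_expR mulNr oppr_le0.
by rewrite mulr_ge0// addr_ge0// mulr_ge0// ltW.
Qed.

Lemma tube_offset z i : 0 < psi z -> `|off i z| < shr z.
Proof.
move=> pz; rewrite -(ltr_pXn2r (n := 2))// ?nnegrE//; last exact/ltW/shrink_gt0.
rewrite real_normK ?num_real//.
apply: (@le_lt_trans _ _ (\sum_j off j z * off j z)).
  by rewrite (bigD1 i)//= -expr2 lerDl sumr_ge0// => j _; rewrite -expr2 sqr_ge0.
by rewrite expr2 -subr_gt0.
Qed.

Lemma tube_decreasing (z : spacetime R) : 0 < z.1 -> z.1 <= t1 -> 0 < psi z ->
  (forall i, `|u (z.1, x + z.1 *: a) 0 i - a 0 i| <= shr z) ->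
  'D_(1, u z) psi z <= 0.
Proof.
move=> z0 zt1 pz near_line; rewrite derive_tube_fun -/(off _) -/shr.
have s0 := shrink_gt0 z; have s1 := shrink_le1 (ltW z0).
have oz i : `|off i z| <= shr z by apply/ltW/tube_offset.
have offE i : off i z = z.2 0 i - (x + z.1 *: a) 0 i.
  by rewrite /off /offset !mxE; ring.
(* [3 * B] comes from moving horizontally to the axis, by at most [shr z] in each of three
   coordinates; the 1 is the assumed deviation on the axis. *)
have dev i : `|u z 0 i - a 0 i| <= (3 * B + 1) * shr z.
  have -> : u z 0 i - a 0 i = (u (z.1, z.2) 0 i - u (z.1, x + z.1 *: a) 0 i) +
      (u (z.1, x + z.1 *: a) 0 i - a 0 i) by rewrite -surjective_pairing; ring.
  apply: le_trans (ler_normD _ _) _; rewrite mulrDl mul1r; apply: lerD => //.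
  apply: le_trans (cylinder_lipschitz i z0 zt1 _) _.
    move=> s ss; apply: offset_cylinder => //; first exact: ltW.
    move=> j; rewrite !mxE.
    have -> : x 0 j + z.1 * a 0 j + s * (z.2 0 j - (x 0 j + z.1 * a 0 j)) - x 0 j -
      z.1 * a 0 j = s * off j z by rewrite /off /offset; ring.
    rewrite normrM; apply: (@le_trans _ _ (1 * 1)); last by rewrite mulr1 ler1n.
    by apply: ler_pM => //; apply: le_trans (oz j) _; exact: le_trans d1.
  rewrite mulrAC mulrC ler_pM2r//.
  rewrite sum3E -!offE; have := oz (inord 0); have := oz (inord 1).
  have := oz (inord 2); lra.
have prod_le i : - ((3 * B + 1) * shr z * shr z) <= off i z * (u z 0 i - a 0 i).
  rewrite lerNl; apply: le_trans (ler_norm _) _; rewrite normrN normrM mulrC.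
  exact: ler_pM.
rewrite sum3E /l; have := prod_le (inord 0); have := prod_le (inord 1).
have := prod_le (inord 2); set P := off _ z * _; set Q := off _ z * _.
set W := off _ z * _; lra.
Qed.

(** The radius decreases in time, so a deviation bounded by its value at [t1] is bounded by the
    radius at every earlier time, as [tube_decreasing] requires. *)
Lemma vacuum_tube (tau : R) : tau <= t1 ->
  (forall t, 0 <= t -> t <= tau -> forall i,
    `|u (t, x + t *: a) 0 i - a 0 i| <= delta * expR (- l * t1)) ->
  forall z : spacetime R, 0 <= z.1 -> z.1 <= tau -> 0 < psi z -> rho z = 0.
Proof.
move=> taut1 near_line z z0 ztau pz; apply/eqP; apply: contraT => rz.
have C'C y : cylinder tau x r y -> C y.
  move=> [/= + Hy]; rewrite in_itv/= => /andP[y0 ytau]; split=> //=.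
  by rewrite in_itv/= y0 (le_trans ytau).
have CC' y : C y -> y.1 <= tau -> cylinder tau x r y.
  move=> [/= + Hy] ytau; rewrite in_itv/= => /andP[y0 _]; split=> //=.
  by rewrite in_itv/= y0.
have psiC (y : spacetime R) : 0 <= y.1 -> y.1 <= tau -> 0 < psi y -> C y.
  move=> y0 yt py; rewrite (surjective_pairing y); apply: offset_cylinder => //.
    exact: le_trans taut1.
  move=> i; apply: le_trans (ltW (tube_offset i py)) _.
  by apply: le_trans (shrink_le1 y0) _; apply: le_trans d1 _; rewrite ler1n.
(* The extra 1 makes the derivative at the maximum strictly negative:
   [D rho - M * rho <= - rho < 0]. *)
pose M := L + 1.
(* The maximum is taken over the compact box, not over the tube. Where [psi <= 0] the product is
   nonpositive because [rho >= 0], so a positive maximum falls inside the tube. *)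
pose m := rho * ((fun y : spacetime R => expR (- M * y.1)) * psi).
have cm : {within cylinder tau x r, continuous m}.
  have sub : cylinder tau x r `<=` slab T by move=> y /C'C; exact: cylinder_slab.
  case: C1rho => cr _ _ _ _.
  have cr' := continuous_subspaceW sub cr.
  have ce : {within cylinder tau x r, continuous
      ((fun y : spacetime R => expR (- M * y.1)) * psi)}.
    apply: continuous_subspaceT => y; apply: differentiable_continuous.
    apply: differentiableM; first exact: differentiable_expRt.
    exact: differentiable_tube_fun.
  by move=> y; apply: cvgM; [exact: cr'|exact: ce].
have Cz : cylinder tau x r z by apply: CC' => //; exact: psiC.
have [zm /[!inE] Czm zmax] :=
  compact_EVT_max (ex_intro _ z Cz) (@compact_cylinder _ _ _ _) cm.
have e_gt0 (y : spacetime R) : 0 < expR (- M * y.1) by exact: expR_gt0.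
have rzm_ge0 : 0 <= rho zm by apply/rho_ge0/cylinder_slab/C'C.
have mzm : 0 < m zm.
  apply: lt_le_trans (zmax z _); last by rewrite inE.
  rewrite /m /= mulr_gt0//; last by rewrite mulr_gt0.
  by rewrite lt_def rz/=; apply/rho_ge0/cylinder_slab/C'C.
have pzm : 0 < psi zm.
  rewrite ltNge; apply/negP => pzm; move: mzm; rewrite ltNge => /negP; apply.
  rewrite /m /=; apply: mulr_ge0_le0 => //; apply: mulr_ge0_le0 => //.
have rzm : 0 < rho zm.
  rewrite lt_def rzm_ge0 andbT; apply: contraTneq mzm => r0.
  by rewrite /m -[(_ * _) zm]/(rho zm * _) r0 mul0r ltxx.
have [zm0 zmtau] : 0 <= zm.1 /\ zm.1 <= tau.
  by case: Czm => /= + _; rewrite in_itv/= => /andP[].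
(* At time 0 the tube lies in the region within [delta] of [x], where the initial density
   vanishes. *)
have zm_gt0 : 0 < zm.1.
  rewrite lt_def zm0 andbT; apply: contraTneq rzm => t0.
  have -> : zm = (0, zm.2) by rewrite -t0 -surjective_pairing.
  have [-> _] : rho (0, zm.2) = rho0 zm.2 /\ u (0, zm.2) = u0 zm.2.
    by case: reg => _ + _ _ _; exact.
  rewrite vac ?ltxx// => i; have := tube_offset i pzm.
  rewrite /off /offset /shr /shrink t0 mul0r subr0 mulr0 expR0 mulr1//.
have zmT : 0 < zm.1 < T by rewrite zm_gt0 (le_lt_trans _ t1T)// (le_trans zmtau).
pose v : spacetime R := (1, u zm).
have drho : is_derive zm v rho ('D_v rho zm).
  by apply/derivableP/diff_derivable; exact: C1_slab_differentiable C1rho zmT.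
have dexp := is_derive_expRt M zm v.
have dpsi : is_derive zm v psi ('D_v psi zm).
  by apply/derivableP/diff_derivable; exact: differentiable_tube_fun.
have [dm DmE] := is_deriveM drho (is_deriveM dexp dpsi).
have Dpsi : 'D_v psi zm <= 0.
  apply: tube_decreasing => //; first exact: le_trans taut1.
  move=> i; apply: le_trans (near_line _ zm0 zmtau i) _.
  rewrite ler_wpM2l ?(ltW d0)// ler_expR !mulNr lerN2 ler_wpM2l//; last first.
    exact: le_trans taut1.
  by rewrite addr_ge0// mulr_ge0// ltW.
have Drho : 'D_v rho zm <= L * rho zm by apply: LP => //; exact: C'C.
have Dneg : 'D_v m zm < 0.
  rewrite DmE -[(_ * psi) zm]/(expR (- M * zm.1) * psi zm) /GRing.scale/=.
  rewrite mulr1; set e := expR _; have e0 : 0 < e by exact: e_gt0.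
  have -> : rho zm * (e * 'D_v psi zm + psi zm * (- M * e)) +
      e * psi zm * 'D_v rho zm =
    e * (rho zm * 'D_v psi zm + psi zm * ('D_v rho zm - M * rho zm)) by ring.
  rewrite pmulr_rlt0// ltr_wnDl//; first by rewrite mulr_ge0_le0// ltW.
  rewrite pmulr_rlt0// /M; lra.
(* Only the backward half-line zm + s v, s <= 0, is used: forwards one may leave
   the time interval [0, tau]. *)
suff : 0 <= 'D_v m zm by rewrite leNgt Dneg.
(* Going back by less than [zm.1] keeps the time positive, and by less than [1 / c] moves each
   coordinate by at most 1. *)
pose sigma := Num.min zm.1 c^-1.
have sigma0 : 0 < sigma by rewrite lt_min zm_gt0 invr_gt0.
have E0 : zm + (0 : R) *: v = zm by rewrite scale0r addr0.
have dm0 : derivable m (zm + (0 : R) *: v) v by rewrite E0.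
have dg := is_derive_line dm0; rewrite E0 in dg.
apply: (derive_ge0_left_max sigma0 dg) => s.
rewrite /sigma => s1 s0; rewrite E0; apply: zmax; rewrite inE.
have [sz sc] : - zm.1 < s /\ - c^-1 < s.
  split; apply: le_lt_trans s1; rewrite lerN2 ge_min lexx ?orbT//.
split=> [|i] /=; rewrite in_itv/=.
  by rewrite (_ : s%:A = s); [apply/andP; split; lra|exact: mulr1].
rewrite -ler_distl !mxE.
have -> : zm.2 0 i + s * u zm 0 i - x 0 i =
  off i zm + zm.1 * a 0 i + s * u zm 0 i by rewrite /off /offset; ring.
have T1 : `|off i zm| <= 1.
  by apply: le_trans (ltW (tube_offset i pzm)) (le_trans (shrink_le1 zm0) d1).
have T2 : `|zm.1 * a 0 i| <= t1 * c.
  rewrite normrM (ger0_norm zm0) ler_pM//; last exact: initial_bound.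
  exact: le_trans taut1.
have T3 : `|s * u zm 0 i| <= 1.
  rewrite normrM ltr0_norm//; apply: (@le_trans _ _ (c^-1 * c)); last first.
    by rewrite mulVf ?gt_eqF.
  apply: ler_pM => //; [by rewrite oppr_ge0 ltW|lra|].
  by apply: velocity_coord_le; apply: cylinder_slab; exact: C'C.
rewrite /r; apply: le_trans (ler_normD _ _) _.
have := ler_normD (off i zm) (zm.1 * a 0 i); lra.
Qed.

End Tube.

(** * Straight characteristics *)

Section Characteristics.
Variables (R : realType) (k gam c T : R) (rho0 : 'rV[R]_3 -> R)
  (u0 : 'rV[R]_3 -> 'rV[R]_3) (rho : spacetime R -> R)
  (u : spacetime R -> 'rV[R]_3).
Hypotheses (gam1 : 1 <= gam) (c0 : 0 < c)
  (reg : regular_solution k gam c rho0 u0 T rho u).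

Let ui (i : 'I_3) z := u z 0 i.

Let C1u : C1_slab T u. Proof. by case: reg => _ _ []. Qed.

(** At interior times [Dt] and [Dx] are derivatives in the directions [(1, 0)] and [(0, u z)];
    differentiability of each component allows them to be added. *)
Lemma vacuum_burgers z i : 0 < z.1 < T -> rho z = 0 -> 'D_(1, u z) (ui i) z = 0.
Proof.
move=> zT rz; have sz : slab T z by case/andP: zT => *; rewrite /slab/= !ltW.
have E : Dt T u z + Dx (u z) u z = 0 by case: reg => _ _ _ _; exact.
have dui j : differentiable (ui j) z by exact: C1_slab_coord_differentiable C1u zT.
have dux : derivable u z (0, u z).
  by apply/derivable_mxP => j m; rewrite ord1; exact: (diff_derivable (dui m)).
have [_ DxE] := derive_space_slice u z (u z).
have -> : 'D_(1, u z) (ui i) z = (Dt T u z + Dx (u z) u z) 0 i.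
  rewrite [RHS]mxE -DxE derive_mx// [X in _ = _ + X]mxE.
  have [_ DtE] := C1_slab_coord ord0 i C1u zT.
  rewrite /Dslab unlift_none dir0 /= in DtE; rewrite -DtE.
  rewrite !deriveE -?linearD; try exact: dui.
  by congr ('d _ z _); congr pair; rewrite /= ?addr0 ?add0r.
by rewrite E mxE.
Qed.

Variables (x : 'rV[R]_3).
Local Notation a := (u0 x).
Let line (t : R) : spacetime R := (t, x + t *: a).
Let w i t := ui i (line t) - a 0 i.

Let lineE t : line t = (0, x) + t *: ((1, a) : spacetime R).
Proof. by rewrite /line; congr pair; rewrite /= add0r; exact/esym/mulr1. Qed.

Let continuous_line : continuous line.
Proof.
move=> t; rewrite /continuous_at (funext lineE).
by apply: cvgD; [exact: cvg_cst|apply: cvgZr_tmp; exact: cvg_id].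
Qed.

Let within_w i tau : tau <= T -> {within `[0, tau]%classic, continuous (w i)}.
Proof.
move=> tauT; have cu : {within `[0, tau]%classic, continuous (ui i \o line)}.
  apply: (continuous_within_comp continuous_line _ (within_ui reg (i := i))) => t.
  rewrite /= in_itv/= /slab/= => /andP[-> H].
  exact: le_trans tauT.
by move=> t; apply: cvgB; [exact: cu|exact: cvg_cst].
Qed.

(** On the line [a = u - w], so the derivative along [(1, a)] is the one along [(1, u)], which
    vanishes in vacuum, minus the spatial derivatives weighted by [w]. The deviation thus solves a
    linear homogeneous system. *)
Lemma velocity_deviation_derive i t : 0 < t < T -> rho (line t) = 0 ->
  is_derive t (1 : R) (w i)
    (- \sum_j w j t * 'D_(dir R (lift ord0 j)) (ui i) (line t)).
Proof.
move=> tT rt; have du : differentiable (ui i) (line t).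
  by apply: C1_slab_coord_differentiable C1u _.
have dl : is_derive t (1 : R) (fun s => ui i (line s)) ('D_(1, a) (ui i) (line t)).
  have dd : derivable (ui i) ((0, x) + t *: ((1, a) : spacetime R)) (1, a).
    by rewrite -lineE; exact: diff_derivable.
  have := is_derive_line dd; rewrite -lineE.
  by under eq_fun do rewrite -lineE.
apply: (is_derive_eq (is_deriveB dl (is_derive_cst (a 0 i) t (1 : R)))).
rewrite subr0 derive_time_space//.
have E : 'D_(1, u (line t)) (ui i) (line t) = 0 by exact: vacuum_burgers.
rewrite derive_time_space// in E.
rewrite -[LHS]subr0 -{2}E opprD addrACA subrr add0r -sumrB -sumrN.
by apply: eq_bigr => j _; rewrite /w /ui; ring.
Qed.

(** A Gronwall argument for the squared deviation, which is 0 at time 0. Vacuum and bounds are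
    needed only at times strictly between 0 and [tau]; continuity covers the endpoints. *)
Lemma velocity_deviation0 (tau B : R) : 0 <= tau -> tau < T -> 0 < B ->
  (forall t, 0 < t -> t < tau -> rho (line t) = 0) ->
  (forall t, 0 < t -> t < tau -> forall m i,
    `|'D_(dir R m) (ui i) (line t)| <= B) ->
  forall i, w i tau = 0.
Proof.
move=> tau0 tauT B0 rho_line DB i.
pose g := \sum_(j < 3) w j * w j.
(* With [S] the sum of the absolute deviations, the derivative of [g] is at most [2 * B * S^2], and
   [S^2 <= 3 * g] in three dimensions; hence the rate [6 * B]. *)
pose E t := expR (- (6 * B) * t).
have gE t : g t = \sum_j w j t * w j t by rewrite /g fct_sumE.
pose G := g * E.
pose W j t := - \sum_n w n t * 'D_(dir R (lift ord0 n)) (ui j) (line t).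
have dw j t : 0 < t -> t < tau -> is_derive t (1 : R) (w j) (W j t).
  move=> t0 tt; apply: velocity_deviation_derive; last exact: rho_line.
  by rewrite t0 (lt_trans tt).
have dE t : is_derive t (1 : R) E (- (6 * B) * E t).
  have dl : is_derive t (1 : R) (fun s : R => - (6 * B) * s) (- (6 * B)).
    by apply: (is_derive_eq (is_deriveZ _ (is_derive_id t (1 : R)))); exact: mulr1.
  apply: (is_derive_eq (is_derive1_comp (is_derive_expR (- (6 * B) * t)) dl)).
  by rewrite [LHS]mulrC.
have dG t : 0 < t -> t < tau -> is_derive t (1 : R) G
    (g t * (- (6 * B) * E t) + E t * \sum_j (w j t * W j t + w j t * W j t)).
  move=> t0 tt; apply: (is_deriveM _ (dE t)).
  apply: is_derive_sum => j; have := is_deriveM (dw j t t0 tt) (dw j t t0 tt).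
  by [].
have W_le j t : 0 < t -> t < tau -> `|W j t| <= B * \sum_n `|w n t|.
  move=> t0 tt; rewrite /W normrN mulr_sumr; apply: le_trans (ler_norm_sum _ _ _) _.
  apply: ler_sum => n _; rewrite normrM mulrC ler_pM//; exact: DB.
have cG : {within `[0, tau]%classic, continuous G}.
  have cw j : {within `[0, tau]%classic, continuous (w j)}.
    by apply: within_w; exact: ltW.
  move=> t; apply: cvgM.
    have -> : g = fun t => w (inord 0) t * w (inord 0) t + w (inord 1) t * w (inord 1) t
        + w (inord 2) t * w (inord 2) t.
      by apply/funext => s; rewrite gE sum3E.
    by do ?apply: cvgD; apply: cvgM; exact: cw.
  have cE : {within `[0, tau]%classic, continuous E}.
    apply: continuous_subspaceT => s; apply: differentiable_continuous.
    by apply/derivable1_diffP; case: (dE s).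
  exact: cE.
have G_le : G tau <= G 0.
  apply: (@ler0_derive1_le_cc _ G 0 tau _ _ cG); rewrite ?in_itv/= ?lexx ?tau0//.
    by move=> t; rewrite in_itv/= => /andP[t0 tt]; case: (dG t t0 tt).
  move=> t; rewrite in_itv/= => /andP[t0 tt]; rewrite derive1E.
  have [_ ->] := dG t t0 tt.
  have E0 : 0 < E t by exact: expR_gt0.
  have -> : g t * (- (6 * B) * E t) + E t * \sum_j (w j t * W j t + w j t * W j t) =
     E t * (\sum_j (w j t * W j t + w j t * W j t) - 6 * B * g t) by ring.
  rewrite pmulr_rle0// subr_le0.
  set S := \sum_n `|w n t|.
  have S3 : S * S <= 3 * g t.
    rewrite gE /S !sum3E; set p := w _ t; set q := w _ t; set s := w _ t.
    have -> : p * p = `|p| * `|p| by rewrite -normrM ger0_norm// -expr2 sqr_ge0.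
    have -> : q * q = `|q| * `|q| by rewrite -normrM ger0_norm// -expr2 sqr_ge0.
    have -> : s * s = `|s| * `|s| by rewrite -normrM ger0_norm// -expr2 sqr_ge0.
    have := sqr_ge0 (`|p| - `|q|); have := sqr_ge0 (`|p| - `|s|).
    have := sqr_ge0 (`|q| - `|s|); lra.
  apply: (@le_trans _ _ (\sum_j 2 * (B * S * `|w j t|))).
    apply: ler_sum => j _; rewrite (_ : _ + _ = 2 * (w j t * W j t)); last by ring.
    rewrite ler_wpM2l//.
    apply: le_trans (ler_norm _) _; rewrite normrM mulrC ler_wpM2r//.
    exact: W_le.
  rewrite -!mulr_sumr -/S.
  have -> : 2 * (B * S * S) = 2 * B * (S * S) by ring.
  have -> : 6 * B * g t = 2 * B * (3 * g t) by ring.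
  by rewrite ler_wpM2l// mulr_ge0// ltW.
have w0 j : w j 0 = 0.
  rewrite /w /ui /line scale0r addr0.
  have [_ ->] : rho (0, x) = rho0 x /\ u (0, x) = u0 x.
    by case: reg => _ + _ _ _; exact.
  exact: subrr.
have G0 : G 0 = 0.
  by rewrite /G -[LHS]/(g 0 * E 0) gE big1 ?mul0r// => j _; rewrite w0 mulr0.
have gle : g tau <= 0.
  by move: G_le; rewrite G0 -[G tau]/(g tau * E tau) pmulr_lle0// expR_gt0.
have sq j : w j tau * w j tau <= g tau.
  rewrite gE (bigD1 j)//= lerDl sumr_ge0// => n _; by rewrite -expr2 sqr_ge0.
have := le_trans (sq i) gle; rewrite -expr2 => H.
by apply/eqP; rewrite -sqrf_eq0 eq_le H sqr_ge0.
Qed.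

Lemma characteristic_line (t1 delta : R) : 0 < t1 -> t1 < T ->
  0 < delta -> delta <= 1 ->
  (forall y : 'rV[R]_3, (forall i, `|y 0 i - x 0 i| < delta) -> rho0 y = 0) ->
  forall t i, 0 <= t -> t <= t1 -> w i t = 0.
Proof.
move=> t1_gt0 t1T d0 d1 vac.
have [B B0 BP] := Dslab_bounded x (2 + t1 * c) (ltW t1T) C1u.
have [L _ LP] := transport_growth gam1 c0 reg x t1T.
pose l := 9 * B + 3; pose eta := delta * expR (- l * t1).
have eta0 : 0 < eta by rewrite mulr_gt0// expR_gt0.
(* The bound is assumed only strictly before [tau], which is all that is known at a first exit time.
   The tube lemma needs a closed time interval and is therefore applied on [[0, t]] for each
   [t < tau]. *)
have small tau : 0 <= tau -> tau <= t1 ->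
    (forall t, 0 <= t -> t < tau -> forall i, `|w i t| <= eta) ->
    forall i, w i tau = 0.
  move=> tau0 taut1 wle.
  apply: (velocity_deviation0 tau0 (le_lt_trans taut1 t1T) B0).
    move=> t t_gt0 tt; have tt1 := le_trans (ltW tt) taut1.
    apply: (vacuum_tube c0 reg t1_gt0 t1T B0 BP LP d0 d1 vac tt1) => /=.
    + by move=> s s0 st i; apply: wle => //; exact: le_lt_trans tt.
    + exact: ltW.
    + by [].
    rewrite /tube_fun big1 ?subr0; first by rewrite mulr_gt0// shrink_gt0.
    by move=> i _; rewrite /offset /= !mxE; ring.
  move=> t t_gt0 tt m i; have tT : 0 < (line t).1 < T.
    by rewrite /= t_gt0 (lt_trans tt)// (le_lt_trans taut1).
  rewrite (C1_slab_coord m i C1u tT).2; apply: BP.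
  rewrite /line; apply: (offset_cylinder reg t1_gt0 t1T); first exact: ltW.
    by apply: le_trans taut1; exact: ltW.
  by move=> j; rewrite !mxE (_ : _ - _ - _ = 0) ?normr0//; ring.
(* [inf A] would be the first time at which the deviation reaches [eta]; before
   it the deviation vanishes, which contradicts continuity. *)
pose A := [set t : R | 0 <= t <= t1 /\ exists i, eta <= `|w i t|].
have [A0|/set0P[t2 At2]] := eqVneq A set0.
  move=> t i t0 tt1; apply: small => // s s0 st j.
  rewrite leNgt; apply/negP => H; have : A s.
    by split; [rewrite s0 (le_trans (ltW st))|exists j; exact: ltW].
  by rewrite A0.
exfalso; pose s := inf A.
have hA : has_inf A.
  by split; [exists t2|exists 0 => t [/andP[]]].
have s0 : 0 <= s by apply: lb_le_inf; [exists t2|move=> t [/andP[]]].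
have slow t : A t -> s <= t by move=> At; apply: ge_inf => //; case: hA.
have st1 : s <= t1.
  by apply: le_trans (slow _ At2) _; case: At2 => /andP[].
have below t : 0 <= t -> t < s -> forall i, `|w i t| < eta.
  move=> t0 ts i; rewrite ltNge; apply/negP => H.
  have : A t by split; [rewrite t0 (le_trans (ltW ts))|exists i].
  by move=> /slow; rewrite leNgt ts.
have ws i : w i s = 0.
  by apply: small => // t t0 ts j; apply/ltW/below.
have near_s : \forall t \near s, forall i, 0 <= t <= t1 -> `|w i t| < eta.
  have nm i : \forall t \near s, 0 <= t <= t1 -> `|w i t| < eta.
    have cw : {within `[0, t1]%classic, continuous (w i)}.
      by apply: within_w; exact: ltW.
    have sI : `[0, t1]%classic s by rewrite /= in_itv/= s0.
    have cs : w i t @[t --> within `[0, t1] (nbhs s)] --> w i s.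
      by move/subspace_continuousP: cw => /(_ s sI).
    rewrite ws in cs.
    have N : \forall t \near within `[0, t1] (nbhs s), `|w i t| < eta.
      exact: ((cvgr0Pnorm_lt (w i)).1 cs).
    have {}N : nbhs s (fun t => `[0, t1]%classic t -> `|w i t| < eta) by exact: N.
    move: N; by apply: filterS => t Ht tI; apply: Ht; rewrite /= in_itv.
  exact: (@filter_forall _ _ _ _ _ nm).
have [e e0 He] := near_norm_ball near_s.
have [t At ts] := inf_adherent e0 hA.
case: (At) => tI [i]; rewrite leNgt => /negP; apply.
apply: He => //; rewrite ger0_norm ?subr_ge0 ?slow//.
by rewrite ltrBlDl.
Qed.

End Characteristics.

(** * Collapse of the characteristics and conclusion *)

Lemma row_norm_le (R : realType) (v : 'rV[R]_3) (e : R) : 0 <= e ->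
  (forall i, `|v 0 i| <= e) -> `|v| <= e.
Proof.
move=> e0 H; rewrite [X in X <= _]/Num.norm/= mx_normrE.
by apply/bigmax_leP; split=> // -[i j] _; rewrite ord1.
Qed.

(** Openness of [V] provides a vacuum neighbourhood of each of its points [y]. Having the identity
    at all these points, and not just at one, is what allows it to be differentiated in [y]. *)
Lemma characteristic_from_vacuum (R : realType) (k gam c T t1 : R)
    (rho0 : 'rV[R]_3 -> R) (u0 : 'rV[R]_3 -> 'rV[R]_3) (rho : spacetime R -> R)
    (u : spacetime R -> 'rV[R]_3) (V : set 'rV[R]_3) (y : 'rV[R]_3) i :
  1 <= gam -> 0 < c -> regular_solution k gam c rho0 u0 T rho u ->
  open V -> (forall z, V z -> rho0 z = 0) -> V y -> 0 < t1 -> t1 < T ->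
  u (t1, y + t1 *: u0 y) 0 i = u0 y 0 i.
Proof.
move=> gam1 c0 reg oV V0 Vy t1_gt0 t1T.
have [d d0 dV] := near_norm_ball (open_nbhs_nbhs (conj oV Vy)).
pose delta := Num.min 1 (d / 2).
have delta0 : 0 < delta by rewrite lt_min ltr01 divr_gt0.
have delta1 : delta <= 1 by rewrite ge_min lexx.
have deltad : delta < d.
  by apply: (@le_lt_trans _ _ (d / 2)); [rewrite ge_min lexx orbT|lra].
have vac (z : 'rV[R]_3) : (forall j, `|z 0 j - y 0 j| < delta) -> rho0 z = 0.
  move=> zy; apply/V0/dV; apply: le_lt_trans deltad.
  by apply: row_norm_le => [|j]; [exact: ltW|rewrite !mxE ltW].
have := characteristic_line gam1 c0 reg t1_gt0 t1T delta0 delta1 vac i (ltW t1_gt0) (lexx _).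
by move=> /eqP; rewrite subr_eq0 => /eqP.
Qed.

Lemma no_negative_eigenvalue (R : realType) (u0 : 'rV[R]_3 -> 'rV[R]_3)
    (U : 'I_3 -> spacetime R -> R) (x v : 'rV[R]_3) (al t1 : R) :
  differentiable u0 x -> 'D_v u0 x = al *: v -> 1 + t1 * al = 0 ->
  (forall i, differentiable (U i) (t1, x + t1 *: u0 x)) ->
  (forall i, \forall y \near x, U i (t1, y + t1 *: u0 y) = u0 y 0 i) ->
  al *: v = 0.
Proof.
move=> du0 Dv t1al dU UE; apply/rowP => i; rewrite -Dv.
pose g y := y + t1 *: u0 y.
have dg : differentiable g x.
  by apply: differentiableD => //; apply: differentiableZ.
have Dg : 'd g x v = 0.
  have Du0 : is_derive x v u0 (al *: v) by rewrite -Dv; exact/derivableP/diff_derivable.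
  rewrite -deriveE//.
  have [_ ->] := is_deriveD (is_derive_id x v) (is_deriveZ t1 Du0).
  by rewrite scalerA -[X in X + _]scale1r -scalerDl t1al scale0r.
(* Time is frozen at [t1], and the chain rule uses the differentiability of [U i] in all space-time
   variables: [Q] has derivative 0 along [v], hence so does [U i \o Q], which is [u0] near [x]. *)
pose Q y : spacetime R := (t1, g y).
have dQ : differentiable Q x by exact: differentiable_pair.
have DQ : 'd Q x v = 0.
  rewrite (@diff_pair _ _ _ _ (cst t1) g)// /= Dg diff_cst.
  by [].
have -> : 'D_v u0 x 0 i = 'D_v (fun y => u0 y 0 i) x.
  by rewrite derive_mx ?mxE//; exact: diff_derivable.
rewrite -(near_eq_derive v (UE i)) -[fun y => _]/(U i \o Q).
rewrite deriveE; last exact: differentiable_comp.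
by rewrite diff_comp//= DQ linear0 mxE.
Qed.

Theorem theorem3p4 (R : realType) (k gam c : R)
  (hk : 0 < k) (hgam : 1 <= gam) (hc : 0 < c)
  (rho0 : 'rV[R]_3 -> R) (u0 : 'rV[R]_3 -> 'rV[R]_3) (V : set 'rV[R]_3)
  (hV : hyperbolic_singularity_set rho0 u0 V) :
  (max_existence_time k gam c rho0 u0 < +oo)%E.
Proof.
case: hV => -[oV _] [x Vx] V0 VJ.
have [du0 [al [/eigenvalueP[v vA v0] al0]]] := VJ x Vx.
pose t1 := - al^-1.
have t1_gt0 : 0 < t1 by rewrite oppr_gt0 invr_lt0.
apply: (@le_lt_trans _ _ t1%:E); last exact: ltry.
apply: ge_ereal_sup => _ [T [T0 [rho [u reg]]] <-]; rewrite lee_fin leNgt.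
apply/negP => t1T; move/negP: v0; apply.
have C1u : C1_slab T u by case: reg => _ _ [].
have tT : 0 < t1 < T by rewrite t1_gt0.
have H : al *: v = 0.
  apply: (@no_negative_eigenvalue _ u0 (fun i z => u z 0 i) x v al t1) => //.
  (* In the row-vector convention the derivative along [v] is [v *m jacobian u0 x], so the
     eigenvector equation [vA] applies as it stands. *)
  - by rewrite deriveEjacobian.
  - by rewrite /t1 mulNr mulVf ?subrr// lt_eqF.
  - by move=> i; apply: (C1_slab_coord_differentiable i C1u).
  - move=> i; apply: filterS (open_nbhs_nbhs (conj oV Vx)) => y Vy.
    exact: characteristic_from_vacuum reg oV V0 Vy t1_gt0 t1T.
by move/eqP: H; rewrite scaler_eq0 (lt_eqF al0).
Qed.
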